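(* Let $K\in\mathcal{K}^2$ be in isominwidth-bisecting position. Then $$\frac{\mathrm{A}(K)}{\mathrm{w}_B(K)^2}\leq 4,$$ with equality if and only if $K$ is a square.
   Context: $\mathcal{K}^2$ is the family of planar convex bodies (compact convex subsets of $\mathbb{R}^2$) with non-empty interior. For a compact set $S\subset\mathbb{R}^2$, $\mathrm{A}(S)$ is its area (2-dimensional Lebesgue measure) and $\mathrm{w}(S)$ its (minimum) width, i.e. the shortest distance between two parallel lines containing $S$ between them. A bisection of $K\in\mathcal{K}^2$ is a pair of closed sets $(K_1,K_2)$ such that (i) $K=K_1\cup K_2$, and (ii) $K_1\cap K_2=l([-1,1])$, where $l:[-1,1]\to K$ is an injective continuous curve whose endpoints $l(-1),l(1)$ are the only points of the curve lying in the boundary of $K$. $\mathcal{B}(K)$ is the set of all bisections of $K$, and $\mathrm{w}_B(K)=\inf_{(K_1,K_2)\in\mathcal{B}(K)}\max\{\mathrm{w}(K_1),\mathrm{w}(K_2)\}$. A set $K\in\mathcal{K}^2$ is in isominwidth-bisecting position if $$\frac{\mathrm{A}(K)}{\mathrm{w}_B(K)^2}=\inf_{\phi}\frac{\mathrm{A}(\phi(K))}{\mathrm{w}_B(\phi(K))^2},$$ where $\phi$ ranges over all nonsingular affine maps $\phi:\mathbb{R}^2\to\mathbb{R}^2$. *)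

(* Defs.v *)
From HB Require Import structures.
From mathcomp Require Import all_boot all_order all_algebra.
From mathcomp Require Import all_classical all_reals all_analysis.

Set Implicit Arguments.
Unset Strict Implicit.
Unset Printing Implicit Defensive.

Import Order.TTheory GRing.Theory Num.Theory.
Import numFieldNormedType.Exports.

Local Open Scope classical_set_scope.
Local Open Scope ring_scope.

Section Plane.
Context {R : realType}.

(* R * R carries the sup norm, hence the Euclidean topology; lengths and angles
   are Euclidean and always go through [dot]. *)
Local Notation plane := (R * R)%type.

Definition dot (u v : plane) : R := u.1 * v.1 + u.2 * v.2.

Definition convex_body (K : set plane) : Prop :=
  [/\ compact K, convex_set K & K° !=set0].

Definition boundary (S : set plane) : set plane := closure S `\` S°.

(* Finite on compact sets, so taking [fine] loses nothing there. *)
Definition area (S : set plane) : R :=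
  fine ((@lebesgue_measure R \x @lebesgue_measure R)%E S).

(* For a unit vector [u], the lines [dot u x = a] and [dot u x = b] are parallel
   at distance [b - a], and [S] lies between them. *)
Definition width (S : set plane) : R :=
  inf [set d | exists (u : plane) (a b : R),
        [/\ dot u u = 1, a <= b,
            S `<=` [set x | a <= dot u x <= b] & d = b - a]].

(* The curve is a function on all of R; only its values on [-1, 1] matter. *)
Definition bisection (K K1 K2 : set plane) : Prop :=
  [/\ closed K1, closed K2, K = K1 `|` K2 &
      exists l : R -> plane,
        [/\ {within `[-1, 1], continuous l},
            set_inj `[-1, 1] l,
            l @` `[-1, 1] `<=` K,
            (forall t, t \in `[-1, 1] ->
              (boundary K (l t) <-> t = -1 \/ t = 1)) &
            K1 `&` K2 = l @` `[-1, 1]]].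

Definition bisecting_width (K : set plane) : R :=
  inf [set w | exists K1 K2 : set plane,
        bisection K K1 K2 /\ w = Num.max (width K1) (width K2)].

Definition isominwidth_ratio (K : set plane) : R :=
  area K / bisecting_width K ^+ 2.

Definition nonsingular_affine (phi : plane -> plane) : Prop :=
  exists a b c d e f : R,
    a * d - b * c != 0 /\
    forall x, phi x = (a * x.1 + b * x.2 + e, c * x.1 + d * x.2 + f).

Definition isominwidth_bisecting_position (K : set plane) : Prop :=
  isominwidth_ratio K =
  inf [set isominwidth_ratio (phi @` K) | phi in nonsingular_affine].

Definition is_square (K : set plane) : Prop :=
  exists p u v : plane,
    [/\ u != 0, dot u v = 0, dot u u = dot v v &
        K = [set x | exists s t : R,
              [/\ 0 <= s <= 1, 0 <= t <= 1 & x = p + s *: u + t *: v]]].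

End Plane.

(* Main.v *)
(** Two planks covering a convex body have total width at least its width [w]
    (Bang), and cutting a body along the middle line of a thinnest strip gives
    two pieces of width at most [w / 2]; hence the bisecting width is [w / 2],
    and a body in position has the largest width among its affine images of
    the same area.  Stretching along a direction then shows that the contact
    directions, those in which the extent of [K] equals [w], cannot all lie
    within 45 degrees of one line.  Either two contact directions are
    orthogonal, and [K] lies in a square of side [w]; or three of them bound
    a hexagon containing [K], and its area is smaller than [w^2]. *)
Require Import Defs.
From HB Require Import structures.
From mathcomp Require Import all_boot all_order all_algebra.
From mathcomp Require Import all_classical all_reals all_analysis.
From mathcomp Require Import measurable_realfun ring lra.
Import Order.TTheory GRing.Theory Num.Theory.
Import numFieldNormedType.Exports.
Local Open Scope classical_set_scope.
Local Open Scope ring_scope.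

Section Plane.
Context {R : realType}.
Local Notation plane := (R * R)%type.
Local Notation mR := (measurableTypeR R).
Local Notation leb := (@lebesgue_measure R).
Local Notation leb2 := (leb \x leb)%E.

(** * Areas of affine images *)

(** The width is a minimum of extents and need not vary smoothly under linear maps, so the position
    is exploited through an explicit small stretch by [l] along [v] and by [l^-1] across it. It
    turns a unit vector at angle theta to [v] into one of squared norm l^2 cos^2 theta + l^-2 sin^2
    theta, which exceeds 1 as long as |tan theta| < l; this is where 45 degrees comes from. The
    three contact directions result from an extremal choice: [u1] and [u2] are as nearly orthogonal
    as possible, and [u3] is found away from the bisector of the smaller angle between their lines.
    In [u3 = a u1 + b u2], extremality bounds |a| and |b| by 1, and the 45 degrees force a b > 0;
    this lets the third strip cut two opposite corners off the parallelogram formed by the other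
    two. That parallelogram has area w^2 divided by the sine of its angle, more than w^2, so the
    corners have to outweigh the excess. *)

Lemma measurable_line (k c : R) :
  measurable_fun setT (fun y : mR => k * y + c : mR).
Proof.
apply: measurable_funD; last exact: measurable_cst.
exact: mulrl_measurable.
Qed.

(** Uniqueness of Lebesgue measure: [m], the pushforward of [leb] along the line scaled by [|k|],
    agrees with [leb] on half-open intervals. *)
Lemma lebesgue_preimage_line (k c : R) (A : set mR) : k != 0 -> measurable A ->
  leb ((fun y => k * y + c) @^-1` A) = (`|k|^-1%:E * leb A)%E.
Proof.
move=> k0 mA; have k0' : 0 < `|k| by rewrite normr_gt0.
pose m := mscale (NngNum (ltW k0'))
  (pushforward leb (fun y : mR => k * y + c : mR)).
have -> : leb A = m (measurable_line k c) A.
  apply: lebesgue_measure_unique => // X [[a b] _ <-] /=.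
  rewrite /m /mscale /= lebesgue_measure_itv /= lte_fin.
  rewrite [pushforward _ _ _](_ : _ =
    leb ((fun y => k * y + c) @^-1` `]a, b]%classic)) //.
  have [kp|kn] := ltP 0 k.
    rewrite [X in leb X](_ : _ = `]((a - c) / k), ((b - c) / k)]%classic); last first.
      apply/seteqP; split=> y /=; rewrite !in_itv /= ltr_pdivrMr// ler_pdivlMr//;
      rewrite ltrBlDr lerBrDr mulrC//.
    rewrite lebesgue_measure_itv /= lte_fin ltr_pM2r ?invr_gt0// ltrD2r.
    case: ifP => _; last by rewrite mule0.
    rewrite -EFinB -EFinM gtr0_norm//; congr EFin; field; exact: k0.
  have {}kn : k < 0 by rewrite lt_neqAle k0.
  rewrite [X in leb X](_ : _ = `[((b - c) / k), ((a - c) / k)[%classic); last first.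
    apply/seteqP; split=> y /=; rewrite !in_itv /= ltr_ndivlMr// ler_ndivrMr//;
    rewrite ltrBlDr lerBrDr mulrC andbC//.
  rewrite lebesgue_measure_itv /= lte_fin ltr_nM2r ?invr_lt0// ltrD2r.
  case: ifP => _; last by rewrite mule0.
  rewrite -EFinB -EFinM ltr0_norm//; congr EFin; field; exact: k0.
rewrite /m /mscale /= [pushforward _ _ _](_ : _ = leb ((fun y => k * y + c) @^-1` A)) //.
rewrite muleA -EFinM mulVf ?mul1e// gt_eqF//.
Qed.

Lemma measurable_affine_form (a b c : R) :
  measurable_fun setT (fun x : mR * mR => a * x.1 + b * x.2 + c : mR).
Proof.
apply: measurable_funD; last exact: measurable_cst.
apply: measurable_funD.
- by apply: measurable_funM; [exact: measurable_cst|exact: measurable_fst].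
- by apply: measurable_funM; [exact: measurable_cst|exact: measurable_snd].
Qed.

Definition affmap (a b c d e f : R) (x : R * R) : R * R :=
  (a * x.1 + b * x.2 + e, c * x.1 + d * x.2 + f).

Lemma measurable_preimage_affmap a b c d e f (S : set (mR * mR)) :
  measurable S -> measurable ((affmap a b c d e f : mR * mR -> mR * mR) @^-1` S).
Proof.
move=> mS; rewrite -[X in measurable X]setTI.
by apply: measurable_fun_pair => //; exact: measurable_affine_form.
Qed.

Lemma leb2_shear_snd c d f (S : set (mR * mR)) : d != 0 -> measurable S ->
  leb2 (affmap 1 0 c d 0 f @^-1` S) = (`|d|^-1%:E * leb2 S)%E.
Proof.
move=> d0 mS; rewrite /product_measure1 -ge0_integralZl//; last first.
  exact: measurable_fun_xsection.
apply: eq_integral => x _ /=.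
rewrite -(@lebesgue_preimage_line d (c * x + f))//; last exact: measurable_xsection.
congr leb; apply/seteqP; split=> y; rewrite /xsection /= !inE /affmap /=;
  by rewrite mul1r mul0r !addr0 addrA [d * y + _]addrC.
Qed.

(** Swaps the order of integration: [leb2] integrates over sections at fixed first coordinate,
    whereas [leb2_shear_fst] works in sections at fixed second coordinate. *)
Lemma leb2E (S : set (mR * mR)) : measurable S -> leb2 S = (leb \x^ leb)%E S.
Proof.
move=> mS; apply: product_measure_unique => // A B mA mB.
exact: product_measure2E.
Qed.

Lemma leb2_shear_fst a b e (S : set (mR * mR)) : a != 0 -> measurable S ->
  leb2 (affmap a b 0 1 e 0 @^-1` S) = (`|a|^-1%:E * leb2 S)%E.
Proof.
move=> a0 mS; rewrite !leb2E//; last exact: measurable_preimage_affmap.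
rewrite /product_measure2 -ge0_integralZl//; last first.
  exact: measurable_fun_ysection.
apply: eq_integral => y _ /=.
rewrite -(@lebesgue_preimage_line a (b * y + e))//; last exact: measurable_ysection.
congr leb; apply/seteqP; split=> x; rewrite /ysection /= !inE /affmap /=;
  by rewrite mul1r mul0r !addr0 add0r addrA.
Qed.

(** An LU factorisation: when [a != 0] the map is a shear of the first coordinate followed by one of
    the second, and each of them is a one-dimensional affine map on every section. *)
Lemma leb2_preimage_affmap a b c d e f (S : set (mR * mR)) :
  a * d - b * c != 0 -> measurable S ->
  leb2 (affmap a b c d e f @^-1` S) = (`|a * d - b * c|^-1%:E * leb2 S)%E.
Proof.
move=> D0 mS; wlog a0 : a b c d e f S D0 mS / a != 0.
  (* If [a = 0], precomposing with the area-preserving shear (x, y) -> (x, x + y) makes [b] the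
     leading coefficient. *)
  move=> W; have [a0|] := eqVneq a 0; last exact: W.
  have b0 : b != 0.
    by apply: contraNneq D0 => b0; rewrite a0 b0 !mul0r subrr.
  have mM := @measurable_preimage_affmap a b c d e f _ mS.
  have := @leb2_shear_snd 1 1 0 _ (oner_neq0 _) mM.
  rewrite normr1 invr1 mul1e => <-.
  have -> : a * d - b * c = b * d - b * (c + d) by rewrite a0; ring.
  rewrite -(W b b (c + d) d e f)//; last first.
    by rewrite -opprB oppr_eq0; apply: contra D0 => /eqP; rewrite a0 => D; apply/eqP; lra.
  congr (leb2 _); apply/seteqP; split=> x; rewrite /preimage /=;
    by rewrite (_ : affmap _ _ _ _ _ _ (affmap _ _ _ _ _ _ x) =
      affmap b b (c + d) d e f x)// /affmap /= a0; congr (_, _); ring.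
have k0 : d - b * c / a != 0.
  have E : a * d - b * c = a * (d - b * c / a) by field.
  by apply: contraNneq D0 => k0; rewrite E k0 mulr0.
have mM := @measurable_preimage_affmap 1 0 (c / a) (d - b * c / a) 0 (f - c * e / a) _ mS.
have -> : `|a * d - b * c|^-1 = `|a|^-1 * `|d - b * c / a|^-1.
  by rewrite -invfM -normrM; congr (`|_|^-1); field.
rewrite EFinM -muleA -(@leb2_shear_snd (c / a) _ (f - c * e / a))//.
rewrite -(@leb2_shear_fst a b e)//; congr (leb2 _).
by apply/seteqP; split=> x; rewrite /preimage /=;
  rewrite (_ : affmap _ _ _ _ _ _ (affmap _ _ _ _ _ _ x) =
      affmap a b c d e f x)// /affmap /=; congr (_, _); field.
Qed.

Lemma interior_box (S : set plane) (p : plane) : S° p <->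
  exists2 e, 0 < e & forall x, `|x.1 - p.1| < e -> `|x.2 - p.2| < e -> S x.
Proof.
split.
  move=> /nbhs_ballP[e e0 sub]; exists e => // x x1 x2.
  by apply: sub; split; rewrite -ball_normE /= distrC.
move=> [e e0 H]; apply/nbhs_ballP; exists e => // x [].
by rewrite -!ball_normE /= => x1 x2; apply: H; rewrite distrC.
Qed.

Definition box (a b c d : R) : set plane := `[a, b]%classic `*` `[c, d]%classic.

Lemma measurable_box a b c d : measurable (box a b c d : set (mR * mR)).
Proof. exact: measurableX. Qed.

Lemma leb2_box a b c d : a <= b -> c <= d ->
  leb2 (box a b c d) = ((b - a) * (d - c))%:E.
Proof.
move=> ab cd; rewrite product_measure1E//= !lebesgue_measure_itv /= !lte_fin.
case: ltgtP ab => [ab _|//|->]; case: ltgtP cd => [cd _|//|-> _];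
  by rewrite ?mule0 ?mul0e ?subrr ?mulr0 ?mul0r.
Qed.

(** The measurable structure is that of the product, so the open set is written as the countable
    union of the rational boxes that it contains. *)
Lemma open_measurable_plane (S : set plane) : open S ->
  measurable (S : set (mR * mR)).
Proof.
move=> oS.
pose B (q : (rat * rat) * (rat * rat)) : set (mR * mR) :=
  box (ratr q.1.1) (ratr q.1.2) (ratr q.2.1) (ratr q.2.2).
pose F q := if `[< B q `<=` S >] then B q else set0.
have -> : S = \bigcup_q F q.
  apply/seteqP; split=> [p Sp|p [q _]]; last first.
    by rewrite /F; case: asboolP => // /(_ p) H /H.
  have /interior_box[e e0 H] : S° p by have -> : S° = S by apply/interior_id.
  have ratP (z : R) : exists q1 q2 : rat,
      [/\ z - e < ratr q1, ratr q1 <= z, z <= ratr q2 & ratr q2 < z + e].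
    have /rat_in_itvoo[q1 /itvP h1] : z - e < z by lra.
    have /rat_in_itvoo[q2 /itvP h2] : z < z + e by lra.
    by exists q1, q2; rewrite !h1 !h2.
  have [a1 [a2 [h1 h2 h3 h4]]] := ratP p.1.
  have [b1 [b2 [k1 k2 k3 k4]]] := ratP p.2.
  exists ((a1, a2), (b1, b2)) => //; rewrite /F asboolT.
    by split; rewrite /= in_itv/=; apply/andP.
  move=> x [/=]; rewrite !in_itv/= => /andP[u1 u2] /andP[v1 v2].
  by apply: H; rewrite ltr_norml; apply/andP; split; lra.
apply: countable_bigcupT_measurable => [|q].
  exact: countableP.
rewrite /F; case: asboolP => _; last exact: measurable0.
exact: measurable_box.
Qed.

Lemma closed_measurable_plane (S : set plane) : closed S ->
  measurable (S : set (mR * mR)).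
Proof.
move=> cS; rewrite -[S]setCK; apply: measurableC.
by apply: open_measurable_plane; exact: closed_openC.
Qed.

Lemma hausdorff_plane : hausdorff_space plane.
Proof. exact: norm_hausdorff. Qed.

Lemma compact_measurable_plane (S : set plane) : compact S ->
  measurable (S : set (mR * mR)).
Proof.
by move=> /(compact_closed hausdorff_plane); exact: closed_measurable_plane.
Qed.

Lemma compact_sub_box (S : set plane) : compact S ->
  exists2 M, 0 < M & S `<=` box (- M) M (- M) M.
Proof.
move=> /compact_bounded/ex_strict_bound_gt0[M M0 H]; exists M => // x /H /=.
rewrite prod_normE /= gt_max => /andP[h1 h2].
by split; rewrite /= in_itv/= -ler_norml ltW.
Qed.

Lemma leb2_compact (S : set plane) : compact S -> (leb2 S < +oo)%E.
Proof.
move=> cS; have [M M0 SM] := compact_sub_box _ cS.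
apply: (@le_lt_trans _ _ (leb2 (box (- M) M (- M) M))); last first.
  by rewrite leb2_box ?ltry//; lra.
apply: le_measure; rewrite ?inE//; last exact: measurable_box.
exact: compact_measurable_plane.
Qed.

Lemma area_leb2 (S : set plane) : compact S -> leb2 S = (area S)%:E.
Proof.
by move=> cS; rewrite /area fineK// ge0_fin_numE//; exact: leb2_compact.
Qed.

Lemma compact_box a b c d : compact (box a b c d).
Proof. by apply: compact_setX; exact: segment_compact. Qed.

Lemma area_box a b c d : a <= b -> c <= d ->
  area (box a b c d) = (b - a) * (d - c).
Proof. by move=> ab cd; rewrite /area leb2_box. Qed.

Lemma area_le (A B : set plane) : measurable (A : set (mR * mR)) ->
  compact B -> A `<=` B -> area A <= area B.
Proof.
move=> mA cB AB; apply: fine_le.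
- rewrite ge0_fin_numE//; apply: le_lt_trans (leb2_compact _ cB).
  by apply: le_measure; rewrite ?inE//; exact: compact_measurable_plane.
- by rewrite ge0_fin_numE//; exact: leb2_compact.
- by apply: le_measure; rewrite ?inE//; exact: compact_measurable_plane.
Qed.

Lemma area_disjoint_le (A B C : set plane) : compact A -> compact B -> compact C ->
  A `&` B = set0 -> A `|` B `<=` C -> area A + area B <= area C.
Proof.
move=> cA cB cC AB ABC; rewrite -lee_fin EFinD -!area_leb2//.
rewrite -measureU//; try exact: compact_measurable_plane.
by apply: le_measure; rewrite ?inE//; try apply: measurableU;
  exact: compact_measurable_plane.
Qed.

Lemma area_interior_gt0 (A : set plane) : compact A -> A° !=set0 -> 0 < area A.
Proof.
move=> cA [p /interior_box[e e0 H]].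
apply: (@lt_le_trans _ _ (area (box (p.1 - e/2) (p.1 + e/2) (p.2 - e/2) (p.2 + e/2)))).
  by rewrite area_box; [apply: mulr_gt0; lra|lra|lra].
apply: area_le => //; first exact: measurable_box.
move=> x [/=]; rewrite !in_itv/= => /andP[u1 u2] /andP[v1 v2].
by apply: H; rewrite ltr_norml; apply/andP; split; lra.
Qed.

Lemma image_affmap a b c d e f (S : set plane) : a * d - b * c != 0 ->
  let D := a * d - b * c in
  affmap a b c d e f @` S =
  affmap (d / D) (- b / D) (- c / D) (a / D) ((b * f - d * e) / D)
    ((c * e - a * f) / D) @^-1` S.
Proof.
move=> D0 D; apply/seteqP; split=> [_ [x Sx <-]|y Sy].
  rewrite /preimage /= (_ : affmap _ _ _ _ _ _ _ = x)//.
  by rewrite [RHS]surjective_pairing /affmap /D; congr pair => /=; field.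
eexists; first exact: Sy.
by rewrite [RHS]surjective_pairing /affmap /D; congr pair => /=; field.
Qed.

Lemma area_affmap a b c d e f (S : set plane) : a * d - b * c != 0 -> compact S ->
  area (affmap a b c d e f @` S) = `|a * d - b * c| * area S.
Proof.
move=> D0 cS; rewrite image_affmap// /area.
set D := a * d - b * c in D0 *.
have E : d / D * (a / D) - - b / D * (- c / D) = D^-1.
  by rewrite /D; field.
rewrite leb2_preimage_affmap ?E ?invr_eq0//; last exact: compact_measurable_plane.
by rewrite area_leb2// -EFinM /= normfV invrK /area area_leb2.
Qed.

(** * Extents and width *)

Lemma convex_setP (K : set plane) : convex_set K <->
  forall x y t, 0 <= t <= 1 -> K x -> K y -> K (t *: x + (1 - t) *: y).
Proof.
split=> [cK x y t /andP[t0 t1] Kx Ky|H x y l].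
  have := cK x y (Itv01 t0 t1); rewrite !inE => /(_ Kx Ky).
  by [].
rewrite !inE => Kx Ky; apply: H => //.
by apply/andP; split.
Qed.

Lemma continuous_fst1 (p : plane * plane) : {for p, continuous (fun p : plane * plane => p.1.1)}.
Proof. exact: (continuous_comp cvg_fst cvg_fst). Qed.
Lemma continuous_fst2 (p : plane * plane) : {for p, continuous (fun p : plane * plane => p.1.2)}.
Proof. exact: (continuous_comp cvg_fst cvg_snd). Qed.
Lemma continuous_snd1 (p : plane * plane) : {for p, continuous (fun p : plane * plane => p.2.1)}.
Proof. exact: (continuous_comp cvg_snd cvg_fst). Qed.
Lemma continuous_snd2 (p : plane * plane) : {for p, continuous (fun p : plane * plane => p.2.2)}.
Proof. exact: (continuous_comp cvg_snd cvg_snd). Qed.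

Lemma continuous_dot (f g : plane * plane -> plane) (p : plane * plane) :
  {for p, continuous (fun p => (f p).1)} -> {for p, continuous (fun p => (f p).2)} ->
  {for p, continuous (fun p => (g p).1)} -> {for p, continuous (fun p => (g p).2)} ->
  {for p, continuous (fun p => dot (f p) (g p))}.
Proof.
by move=> *; apply: continuousD; apply: continuousM.
Qed.

(** The support function of the difference body K - K. It takes arbitrary vectors, not only unit
    ones, so that a linear map acts on it by transposition ([extent_affmap]). *)
Definition extent (K : set plane) (u : plane) : R :=
  sup [set dot u (p.1 - p.2) | p in K `*` K].

Lemma extentP (K : set plane) (u : plane) : compact K -> K !=set0 ->
  (forall x y, K x -> K y -> dot u (x - y) <= extent K u) /\
  exists x y, [/\ K x, K y & extent K u = dot u (x - y)].
Proof.
move=> cK K0.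
pose f (p : plane * plane) := dot u (p.1 - p.2).
have cf : continuous f.
  move=> p; apply: continuous_dot; try exact: cst_continuous.
    by apply: continuousB; [exact: continuous_fst1|exact: continuous_snd1].
  by apply: continuousB; [exact: continuous_fst2|exact: continuous_snd2].
have [[x y]] := @compact_EVT_max _ _ f (K `*` K)
  (let: ex_intro k Kk := K0 in ex_intro _ (k, k) (conj Kk Kk))
  (compact_setX cK cK) (continuous_subspaceT cf).
rewrite inE => -[/= Kx Ky] H.
have E : extent K u = dot u (x - y).
  apply/eqP; rewrite eq_le; apply/andP; split.
    apply: ge_sup; first by exists (f (x, y)), (x, y).
    by move=> _ [p Kp <-]; apply: (H p); rewrite inE.
  apply: ub_le_sup; last by exists (x, y).
  by exists (f (x, y)) => _ [p Kp <-]; apply: (H p); rewrite inE.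
split; last by exists x, y.
by move=> a b Ka Kb; rewrite E; apply: (H (a, b)); rewrite inE.
Qed.

Definition strip_widths (S : set plane) : set R :=
  [set d | exists (u : plane) (a b : R),
    [/\ dot u u = 1, a <= b, S `<=` [set x | a <= dot u x <= b] & d = b - a]].

Lemma strip_widths_ge0 (S : set plane) : lbound (strip_widths S) 0.
Proof. by move=> _ [u [a [b [_ ab _ ->]]]]; rewrite subr_ge0. Qed.

Lemma width_le (S : set plane) u a b : dot u u = 1 -> a <= b ->
  (forall x, S x -> a <= dot u x <= b) -> width S <= b - a.
Proof.
move=> u1 ab SS; apply: ge_inf; first by exists 0; exact: strip_widths_ge0.
by exists u, a, b.
Qed.

Lemma width_ge0 (S : set plane) : 0 <= width S.
Proof.
have [S0|S0] := pselect (strip_widths S !=set0).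
  by apply: lb_le_inf => //; exact: strip_widths_ge0.
by rewrite /width inf_out// => -[].
Qed.

Lemma width_lt (S K : set plane) c : compact K -> S `<=` K -> width S < c ->
  exists u a b, [/\ dot u u = 1, a <= b, (forall x, S x -> a <= dot u x <= b) & b - a < c].
Proof.
move=> cK SK.
have [M M0 KM] := compact_sub_box _ cK.
move=> /inf_lt[] => [|_ [u [a [b [h1 h2 h3 ->]]]] bac]; last by exists u, a, b.
(* [inf] has a default value on the empty set, so some strip must be exhibited; a box around [K]
   gives one. *)
exists (M - - M), (1, 0), (- M), M; split => //; first by rewrite /dot /=; ring.
  by lra.
move=> x /SK/KM[/=]; rewrite /dot !in_itv /= mul1r mul0r addr0 => ->//.
Qed.

Lemma width_le_extent (K : set plane) u : compact K -> K !=set0 ->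
  dot u u = 1 -> width K <= extent K u.
Proof.
move=> cK K0 u1; have [H [x [y [Kx Ky E]]]] := extentP K u cK K0.
rewrite E (_ : dot u (x - y) = dot u x - dot u y); last by rewrite /dot /=; ring.
apply: (width_le K u) => // [|z Kz].
  by have := H x x Kx Kx; rewrite E /dot /=; lra.
have := H _ _ Kx Kz; have := H _ _ Kz Ky; rewrite E /dot /=; lra.
Qed.

Lemma extent_le_strip (K : set plane) u a b : K !=set0 ->
  (forall x, K x -> a <= dot u x <= b) -> extent K u <= b - a.
Proof.
move=> [k Kk] H; apply: ge_sup; first by exists (dot u (k - k)), (k, k).
move=> _ [[x y] [/= Kx Ky] <-].
by have := H _ Kx; have := H _ Ky; rewrite /dot /=; lra.
Qed.

Lemma extent_strip (K : set plane) u : compact K -> K !=set0 ->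
  exists a, forall x, K x -> a <= dot u x <= a + extent K u.
Proof.
move=> cK K0; have [H [x [y [Kx Ky E]]]] := extentP K u cK K0.
exists (dot u y) => z Kz.
by have := H _ _ Kx Kz; have := H _ _ Kz Ky; rewrite E /dot /=; lra.
Qed.

(** The side of a box around [K] bounds both coordinates of every difference of points of [K]. The
    quantitative form, beyond continuity, is what [position_contact] uses. *)
Lemma extent_lipschitz (K : set plane) : compact K -> K !=set0 ->
  exists2 C, 0 < C & forall u v,
    extent K u <= extent K v + C * (`|u.1 - v.1| + `|u.2 - v.2|).
Proof.
move=> cK K0; have [M M0 KM] := compact_sub_box _ cK.
exists (2 * M) => [|u v]; first by lra.
have [_ [x [y [Kx Ky ->]]]] := extentP K u cK K0.
have [/(_ x y Kx Ky) H _] := extentP K v cK K0.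
have E : dot u (x - y) = dot v (x - y) +
  ((u.1 - v.1) * (x.1 - y.1) + (u.2 - v.2) * (x.2 - y.2)) by rewrite /dot /=; ring.
have [/=] := KM _ Kx; have [/=] := KM _ Ky; rewrite !in_itv /= => y1 y2 x1 x2.
rewrite E [leRHS](_ : _ = extent K v +
  (2 * M * `|u.1 - v.1| + 2 * M * `|u.2 - v.2|)); last by rewrite mulrDr.
apply: lerD => //; apply: lerD.
  apply: le_trans (ler_norm _) _; rewrite normrM mulrC ler_wpM2r//.
  by rewrite ler_norml; lra.
apply: le_trans (ler_norm _) _; rewrite normrM mulrC ler_wpM2r//.
by rewrite ler_norml; lra.
Qed.

Lemma extent_continuous (K : set plane) : compact K -> K !=set0 ->
  continuous (extent K).
Proof.
move=> cK K0 u; have [C C0 H] := extent_lipschitz K cK K0.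
apply/cvgrPdist_le => e e0.
have d0 : 0 < e / (2 * C) by apply: divr_gt0 => //; lra.
near=> v.
have : ball u (e / (2 * C)) v by near: v; apply: (nbhsx_ballx u _ d0).
rewrite -ball_normE /= prod_normE gt_max /= => /andP[h1 h2].
have : C * (`|u.1 - v.1| + `|u.2 - v.2|) <= e.
  apply: (@le_trans _ _ (C * (e / (2 * C) + e / (2 * C)))).
    by rewrite ler_pM2l// lerD// ltW.
  by rewrite le_eqVlt; apply/orP; left; apply/eqP; field; exact/lt0r_neq0.
have := H u v; have := H v u; rewrite ler_norml (distrC v.1) (distrC v.2); lra.
Unshelve. all: by end_near.
Qed.

Lemma compact_circle (P : set plane) : closed P ->
  compact ([set u | dot u u = 1] `&` P).
Proof.
move=> cP; apply: (@subclosed_compact _ _ (box (-1) 1 (-1) 1)); last 2 first.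
- exact: compact_box.
- move=> u [/= u1 _]; split; rewrite /= in_itv/=; apply/andP; move: u1; rewrite /dot; split; nra.
apply: closedI => //.
rewrite (_ : [set _ | _] = (fun u => dot u u) @^-1` [set 1]) //.
apply: closed_comp; last exact: closed_eq.
move=> u _; rewrite /dot; apply: cvgD; apply: cvgM; solve [exact: cvg_fst|exact: cvg_snd].
Qed.

Lemma width_attained (K : set plane) : compact K -> K !=set0 ->
  exists2 u, dot u u = 1 & extent K u = width K.
Proof.
move=> cK K0.
have C0 : ([set u : plane | dot u u = 1] `&` setT) !=set0.
  by exists (1, 0); split => //; rewrite /dot /=; ring.
have [u] := @compact_EVT_min _ _ (extent K) _ C0
  (compact_circle _ closedT) (continuous_subspaceT (extent_continuous K cK K0)).
rewrite inE => -[/= u1 _] H; exists u => //.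
apply/eqP; rewrite eq_le width_le_extent// andbT leNgt; apply/negP.
move=> /(@width_lt _ K _ cK (@subset_refl _ _)) [v [a [b [v1 ab Kv ba]]]].
have := extent_le_strip K v a b K0 Kv.
by have := H v; rewrite inE => /(_ (conj v1 I)); lra.
Qed.

Lemma extentN (K : set plane) u : compact K -> K !=set0 ->
  extent K (- u) = extent K u.
Proof.
move=> cK K0.
have [H1 [x1 [y1 [Kx1 Ky1 E1]]]] := extentP K u cK K0.
have [H2 [x2 [y2 [Kx2 Ky2 E2]]]] := extentP K (- u) cK K0.
have := H1 _ _ Ky2 Kx2; have := H2 _ _ Ky1 Kx1; rewrite E1 E2 /dot /=; lra.
Qed.

Lemma extentZ (K : set plane) u t : compact K -> K !=set0 -> 0 <= t ->
  extent K (t *: u) = t * extent K u.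
Proof.
move=> cK K0 t0.
have [H1 [x1 [y1 [Kx1 Ky1 E1]]]] := extentP K u cK K0.
have [H2 [x2 [y2 [Kx2 Ky2 E2]]]] := extentP K (t *: u) cK K0.
have S x y : dot (t *: u) (x - y) = t * dot u (x - y).
  by rewrite /dot /= /GRing.scale /=; ring.
apply/eqP; rewrite eq_le; apply/andP; split.
  by rewrite E2 S ler_wpM2l ?H1.
by rewrite E1 -S H2.
Qed.

Lemma extent_ge_norm (K : set plane) g : compact K -> K !=set0 ->
  width K * Num.sqrt (dot g g) <= extent K g.
Proof.
move=> cK K0.
have gg : 0 <= dot g g by rewrite /dot addr_ge0// -expr2 sqr_ge0.
have [E|n0] := eqVneq (Num.sqrt (dot g g)) 0.
  have [H _] := extentP K g cK K0; have [k Kk] := K0.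
  by rewrite E mulr0; apply: le_trans (H k k Kk Kk); rewrite subrr /dot /= !mulr0 addr0.
set n := Num.sqrt _ in n0 *.
have {}n0 : 0 < n by rewrite lt_neqAle eq_sym n0 sqrtr_ge0.
have nn : dot g g = n ^+ 2 by rewrite sqr_sqrtr.
have v1 : dot (n^-1 *: g) (n^-1 *: g) = 1.
  transitivity (n^-1 ^+ 2 * dot g g); first by rewrite /dot /= /GRing.scale /=; ring.
  by rewrite nn -exprMn mulVf ?expr1n ?gt_eqF.
have := width_le_extent K _ cK K0 v1.
by rewrite extentZ ?invr_ge0 ?(ltW n0)// mulrC ler_pdivlMr.
Qed.

(** * Covering by two planks *)

Lemma dot_le_norm (g z : plane) n : 0 <= n -> dot g g = n ^+ 2 -> dot z z = 1 ->
  dot g z <= n.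
Proof.
move=> n0 gn z1; have [/le_trans->//|d0] := leP (dot g z) 0.
rewrite -ler_sqr ?nnegrE ?(ltW d0)// -gn -[leRHS]mulr1 -z1 /dot -subr_ge0.
by rewrite [leRHS](_ : _ = (g.1 * z.2 - g.2 * z.1) ^+ 2) ?sqr_ge0//; ring.
Qed.

(** First-order condition at a minimum; one well-chosen [t] replaces the limit at 0. *)
Lemma le0_of_slope (c s : R) : 0 <= s ->
  (forall t, 0 < t <= 1 -> 2 * c <= t * s) -> c <= 0.
Proof.
move=> s0 H; rewrite leNgt; apply/negP => c0.
have cs : 0 < c + s by lra.
have := H (c / (c + s)); rewrite divr_gt0// ler_pdivrMr// => /(_ ltac:(lra)).
by rewrite mulrAC ler_pdivlMr//; nra.
Qed.

(* Otherwise [d z] lies outside the compact convex set [K - K], and the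
   direction from its nearest point there to [d z] has extent less than [d]. *)
Lemma chord_of_width (K : set plane) (z : plane) d : compact K -> convex_set K ->
  K !=set0 -> dot z z = 1 -> 0 <= d <= width K -> exists2 x, K x & K (x + d *: z).
Proof.
move=> cK /convex_setP vK K0 z1 /andP[d0 dw].
pose h (p : plane * plane) : plane := d *: z - (p.1 - p.2).
pose f p := dot (h p) (h p).
have cf : continuous f.
  have h1 p : {for p, continuous (fun p => (h p).1)}.
    apply: continuousB; first exact: cst_continuous.
    by apply: continuousB; [exact: continuous_fst1|exact: continuous_snd1].
  have h2 p : {for p, continuous (fun p => (h p).2)}.
    apply: continuousB; first exact: cst_continuous.
    by apply: continuousB; [exact: continuous_fst2|exact: continuous_snd2].
  by move=> p; exact: continuous_dot.
have KK0 : K `*` K !=set0 by have [k Kk] := K0; exists (k, k).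
have [[y0 x0]] := @compact_EVT_min _ _ f _ KK0 (compact_setX cK cK)
  (continuous_subspaceT cf).
rewrite inE => -[/= Ky0 Kx0] H.
pose g := h (y0, x0).
have Hg y x : K y -> K x -> dot g (y - x) <= dot g (y0 - x0).
  move=> Ky Kx; pose q := (y - x) - (y0 - x0).
  suff : dot g q <= 0 by rewrite /q /dot /=; lra.
  apply: (@le0_of_slope _ (dot q q)) => [|t /andP[t0 t1]].
    by rewrite /dot addr_ge0// -expr2 sqr_ge0.
  have t01 : 0 <= t <= 1 by rewrite (ltW t0).
  have := H (t *: y + (1 - t) *: y0, t *: x + (1 - t) *: x0).
  rewrite inE => /(_ (conj (vK _ _ _ t01 Ky Ky0) (vK _ _ _ t01 Kx Kx0))).
  rewrite -subr_ge0 [leRHS](_ : _ = t * (t * dot q q - 2 * dot g q)).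
    by rewrite pmulr_rge0// subr_ge0.
  by rewrite /f /g /h /q /dot /= /GRing.scale /=; ring.
have [g0|g0] := eqVneq (dot g g) 0.
  exists x0 => //; rewrite (_ : _ + _ = y0)//.
  have := g0; rewrite /dot => /eqP; rewrite paddr_eq0 -?expr2 ?sqr_ge0//.
  rewrite !sqrf_eq0 /g /h /= => /andP[/eqP e1 /eqP e2].
  rewrite [RHS]surjective_pairing [LHS]surjective_pairing /=.
  by congr pair; move: e1 e2 => /=; lra.
have gg : 0 <= dot g g by rewrite /dot addr_ge0// -expr2 sqr_ge0.
have {g0}gg : 0 < dot g g by rewrite lt_neqAle eq_sym g0.
pose n := Num.sqrt (dot g g).
have n0 : 0 < n by rewrite sqrtr_gt0.
have nn : dot g g = n ^+ 2 by rewrite sqr_sqrtr ?ltW.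
(* With [g] nonzero, [width K * n <= extent K g <= d * dot g z - n ^+ 2 <= d * n - n ^+ 2], against
   [d <= width K]. *)
have := extent_ge_norm K g cK K0; rewrite -/n.
have [_ [y [x [Ky Kx ->]]]] := extentP K g cK K0.
move=> /le_trans/(_ (Hg _ _ Ky Kx)).
have -> : dot g (y0 - x0) = d * dot g z - dot g g.
  by rewrite /g /h /dot /= /GRing.scale /=; ring.
have := dot_le_norm g z n (ltW n0) nn z1; rewrite nn => gz wn.
have : d * dot g z <= d * n by rewrite ler_wpM2l.
have : d * n <= width K * n by rewrite ler_wpM2r// ltW.
have : 0 < n ^+ 2 by rewrite exprn_gt0.
lra.
Qed.

(* A chord [x, x + w u1] with [w = width K] gives the homothetic copy
   [(1 - l) K + l x] of [K] inside [K `&` (K - d1 u1)], where [l = d1 / w]. *)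
Lemma parallelogram_of_width (K : set plane) (u1 u2 : plane) d1 d2 :
  compact K -> convex_set K -> K !=set0 -> dot u1 u1 = 1 -> dot u2 u2 = 1 ->
  0 < d1 -> 0 < d2 -> d1 + d2 <= width K ->
  exists q, [/\ K q, K (q + d1 *: u1), K (q + d2 *: u2)
    & K (q + d1 *: u1 + d2 *: u2)].
Proof.
move=> cK vK K0 e1 e2 p1 p2 dw; set w := width K in dw *.
have w0 : 0 < w by lra.
have w1 : 0 < w - d1 by lra.
have [|x Kx Kxw] := @chord_of_width K u1 w cK vK K0 e1.
  by rewrite (ltW w0) lexx.
(* The contraction by [1 - d1 / w] brings this length down to [d2]; the length is at most [w]
   because [d1 + d2 <= w]. *)
have [|k Kk Kkd] := @chord_of_width K u2 (d2 * w / (w - d1)) cK vK K0 e2.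
  rewrite divr_ge0 ?mulr_ge0 ?(ltW p2) ?(ltW w0) ?(ltW w1)//=.
  by rewrite ler_pdivrMr// mulrC ler_pM2l//; lra.
have l01 : 0 <= 1 - d1 / w <= 1.
  by rewrite subr_ge0 ler_pdivrMr// gerBl divr_ge0 ?(ltW p1) ?(ltW w0)// mul1r; lra.
have {}vK a b : K a -> K b -> K ((1 - d1 / w) *: a + (d1 / w) *: b).
  move=> Ka Kb; have /convex_setP /(_ a b _ l01 Ka Kb) := vK.
  by rewrite subKr.
have w0' := lt0r_neq0 w0; have w1' := lt0r_neq0 w1.
exists ((1 - d1 / w) *: k + (d1 / w) *: x); split.
- exact: vK.
- rewrite (_ : _ + _ *: u1 = (1 - d1 / w) *: k + (d1 / w) *: (x + w *: u1)); first exact: vK.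
  by rewrite scalerDr scalerA divfK// addrA.
- rewrite (_ : _ + _ *: u2 = (1 - d1 / w) *: (k + (d2 * w / (w - d1)) *: u2) + (d1 / w) *: x).
    exact: vK.
  rewrite scalerDr scalerA addrAC; congr (_ + _ *: _ + _); field; exact/andP.
- rewrite (_ : _ + _ *: u2 = (1 - d1 / w) *: (k + (d2 * w / (w - d1)) *: u2) +
    (d1 / w) *: (x + w *: u1)); first exact: vK.
  rewrite !scalerDr !scalerA divfK// addrAC [in RHS]addrA; congr (_ + _).
  rewrite addrAC; congr (_ + _ *: _ + _); field; exact/andP.
Qed.

(* Opposite vertices of a parallelogram in [K] whose sides are longer than the
   planks are wide share no plank, once the acute angle is chosen. *)
Lemma width_le_two_planks (K : set plane) u1 a1 b1 u2 a2 b2 :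
  compact K -> convex_set K -> K !=set0 -> dot u1 u1 = 1 -> dot u2 u2 = 1 ->
  a1 <= b1 -> a2 <= b2 ->
  (forall x, K x -> a1 <= dot u1 x <= b1 \/ a2 <= dot u2 x <= b2) ->
  width K <= (b1 - a1) + (b2 - a2).
Proof.
move=> cK vK K0 e1 e2 ab1 ab2 KS.
wlog d0 : u2 a2 b2 e2 ab2 KS / 0 <= dot u1 u2.
  move=> W; have [|d0] := leP 0 (dot u1 u2); first exact: W.
  rewrite [b2 - a2](_ : _ = - a2 - - b2); last by lra.
  apply: (W (- u2)).
  - by rewrite -e2 /dot /=; ring.
  - by lra.
  - move=> x /KS[]; first by left.
    by right; move: b; rewrite /dot /=; lra.
  - by move: d0; rewrite /dot /=; lra.
rewrite leNgt; apply/negP => lt.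
(* Half of the excess: the sides become longer than the planks are wide, and still add up to
   [width K]. *)
pose e := (width K - ((b1 - a1) + (b2 - a2))) / 2.
have e0 : 0 < e by rewrite /e; lra.
have [||| q [q1 q2 q3 q4]] := @parallelogram_of_width K u1 u2
  (b1 - a1 + e) (b2 - a2 + e) cK vK K0 e1 e2.
- by lra.
- by lra.
- by rewrite /e; lra.
have f1 : dot u1 (q + (b1 - a1 + e) *: u1) = dot u1 q + (b1 - a1 + e).
  by rewrite -[X in _ = _ + X]mulr1 -e1 /dot /= /GRing.scale /=; ring.
have g1 : dot u2 (q + (b2 - a2 + e) *: u2) = dot u2 q + (b2 - a2 + e).
  by rewrite -[X in _ = _ + X]mulr1 -e2 /dot /= /GRing.scale /=; ring.
have f2 : dot u1 (q + (b1 - a1 + e) *: u1 + (b2 - a2 + e) *: u2) =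
   dot u1 (q + (b2 - a2 + e) *: u2) + (b1 - a1 + e).
  by rewrite -[X in _ = _ + X]mulr1 -e1 /dot /= /GRing.scale /=; ring.
have f3 : dot u1 (q + (b2 - a2 + e) *: u2) = dot u1 q + (b2 - a2 + e) * dot u1 u2.
  by rewrite /dot /= /GRing.scale /=; ring.
have g2 : dot u2 (q + (b1 - a1 + e) *: u1 + (b2 - a2 + e) *: u2) =
   dot u2 (q + (b1 - a1 + e) *: u1) + (b2 - a2 + e).
  by rewrite -[X in _ = _ + X]mulr1 -e2 /dot /= /GRing.scale /=; ring.
have g3 : dot u2 (q + (b1 - a1 + e) *: u1) = dot u2 q + (b1 - a1 + e) * dot u1 u2.
  by rewrite /dot /= /GRing.scale /=; ring.
have h1 : 0 <= (b2 - a2 + e) * dot u1 u2 by rewrite mulr_ge0//; lra.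
have h2 : 0 <= (b1 - a1 + e) * dot u1 u2 by rewrite mulr_ge0//; lra.
(* If [q] is in the first plank, then its neighbour along [u1] and the opposite vertex are not, so
   both lie in the second; but they differ by a side along [u2], too long for that plank. The other
   case is symmetric. *)
move: (KS _ q1) (KS _ q2) (KS _ q3) (KS _ q4); rewrite f2 f3 g2 g3 f1 g1.
by move=> [] ? [] ? [] ? [] ?; lra.
Qed.

(** * The bisecting width *)

(** The homothety with centre [p] and ratio [t] carries a box around [z] into [K]. *)
Lemma interior_conv (K : set plane) z p t : convex_set K -> K° z -> K p ->
  0 < t <= 1 -> K° (t *: z + (1 - t) *: p).
Proof.
move=> /convex_setP vK /interior_box[e e0 H] Kp /andP[t0 t1].
apply/interior_box; exists (t * e) => [|x]; first exact: mulr_gt0.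
rewrite /= /GRing.scale /= => h1 h2.
have t0' := lt0r_neq0 t0.
pose y : plane := ((x.1 - (1 - t) * p.1) / t, (x.2 - (1 - t) * p.2) / t).
have Ky : K y.
  apply: H; rewrite /y /=.
    rewrite -(ltr_pM2l t0) -[X in X * `|_|](gtr0_norm t0) -normrM.
    by rewrite (_ : t * _ = x.1 - (t * z.1 + (1 - t) * p.1))//; field.
  rewrite -(ltr_pM2l t0) -[X in X * `|_|](gtr0_norm t0) -normrM.
  by rewrite (_ : t * _ = x.2 - (t * z.2 + (1 - t) * p.2))//; field.
have -> : x = t *: y + (1 - t) *: p.
  rewrite [LHS]surjective_pairing [RHS]surjective_pairing /y.
  by congr pair; rewrite /= /GRing.scale /=; field.
by apply: vK => //; rewrite (ltW t0).
Qed.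

Definition perp (u : plane) : plane := (- u.2, u.1).

Lemma perp1 (u : plane) : dot u u = 1 -> dot (perp u) (perp u) = 1.
Proof. by move=> <-; rewrite /dot /=; ring. Qed.

Lemma frame_inj (u x y : plane) : dot u u = 1 -> dot u x = dot u y ->
  dot (perp u) x = dot (perp u) y -> x = y.
Proof.
move=> u1 e1 e2.
have E z : z = ((u.1 * dot u z - u.2 * dot (perp u) z) / dot u u,
    (u.2 * dot u z + u.1 * dot (perp u) z) / dot u u).
  by rewrite u1 [LHS]surjective_pairing !divr1 -[z.1]mulr1 -[z.2]mulr1 -u1 /dot /=;
    congr pair; ring.
by rewrite (E x) (E y) e1 e2.
Qed.

Lemma unit_coord_le1 (u : plane) : dot u u = 1 -> `|u.1| <= 1 /\ `|u.2| <= 1.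
Proof. by rewrite /dot => u1; split; rewrite ler_norml; apply/andP; split; nra. Qed.

Lemma dotDr (u x y : plane) : dot u (x + y) = dot u x + dot u y.
Proof. by rewrite /dot /=; ring. Qed.
Lemma dotZr (u x : plane) t : dot u (t *: x) = t * dot u x.
Proof. by rewrite /dot /= /GRing.scale /=; ring. Qed.

Lemma interior_translate (K : set plane) x v : dot v v = 1 -> K° x ->
  exists2 e, 0 < e & forall t, `|t| <= e -> K (x + t *: v).
Proof.
move=> v1 /interior_box[e e0 H]; exists (e / 2) => [|t te]; first by lra.
have [h1 h2] := unit_coord_le1 v v1.
apply: H; rewrite /= addrC addKr /GRing.scale /= normrM;
  apply: (@le_lt_trans _ _ (e / 2 * 1)); rewrite ?ler_pM//; lra.
Qed.

Lemma continuous_dotr (u : plane) : continuous (dot u : plane -> R).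
Proof.
move=> x; rewrite /dot; apply: cvgD; apply: cvgM;
  solve [exact: cvg_cst|exact: cvg_fst|exact: cvg_snd].
Qed.

(** The chord on the middle line is an admissible curve because it passes through an interior point
    [z0] of [K]: then only its ends are boundary points. *)
Lemma midline_bisection (K : set plane) : convex_body K ->
  exists K1 K2 u a m b, [/\ bisection K K1 K2, dot u u = 1,
    forall x, K1 x -> a <= dot u x <= m, forall x, K2 x -> m <= dot u x <= b &
    [/\ a <= m, m <= b, m - a = width K / 2 & b - m = width K / 2]].
Proof.
move=> [cK vK [z Kz]].
have K0 : K !=set0 by exists z; exact: interior_subset.
have clK := compact_closed hausdorff_plane cK.
have [u u1 Ew] := width_attained K cK K0.
have [HE [x1 [y1 [Kx1 Ky1 E1]]]] := extentP K u cK K0.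
pose w := width K; have w0 : 0 <= w := width_ge0 K.
pose a := dot u y1; pose m := a + w / 2; pose b := a + w.
have Eb : dot u x1 = b.
  by move: E1; rewrite /b /w -Ew /a => ->; rewrite /dot /=; ring.
have KS x : K x -> a <= dot u x <= b.
  move=> Kx; have := HE _ _ Kx Ky1; have := HE _ _ Kx1 Kx.
  rewrite Ew -/w -Eb /a; move: Eb; rewrite /b /a /dot /=; lra.
pose v := perp u; have v1 : dot v v = 1 := perp1 u u1.
have uv x t : dot u (x + t *: v) = dot u x by rewrite /v /dot /= /GRing.scale /=; ring.
have vv x t : dot v (x + t *: v) = dot v x + t by rewrite dotDr dotZr v1 mulr1.
(* [z] lies strictly inside the strip; moving it towards the contact point beyond the middle line
   reaches that line while still in the interior. *)
have [z0 Kz0 z0m] : exists2 z0, K° z0 & dot u z0 = m.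
  have [e e0 /= He] := interior_translate K z u u1 Kz.
  have az : a < dot u z.
    have /andP[+ _] := KS _ (He (- e) (ltac:(rewrite normrN gtr0_norm//))).
    by rewrite dotDr dotZr u1; lra.
  have zb : dot u z < b.
    have /andP[_] := KS _ (He e (ltac:(rewrite gtr0_norm//))).
    by rewrite dotDr dotZr u1; lra.
  have [mz|mz] := leP m (dot u z).
    pose t := (m - a) / (dot u z - a).
    exists (t *: z + (1 - t) *: y1).
      apply: interior_conv => //; rewrite /t divr_gt0 ?ler_pdivrMr//;
        rewrite /m /b in az zb mz *; lra.
    rewrite dotDr !dotZr /t -/a; field; lra.
  pose t := (b - m) / (b - dot u z).
  exists (t *: z + (1 - t) *: x1).
    apply: interior_conv => //; rewrite /t divr_gt0 ?ler_pdivrMr//;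
      rewrite /m /b in az zb mz *; lra.
  rewrite dotDr !dotZr /t Eb; field; lra.
pose L := K `&` [set x | dot u x = m].
have L0 : L !=set0 by exists z0; split => //; exact: interior_subset.
have clL : closed [set x | dot u x = m].
  rewrite (_ : [set _ | _] = dot u @^-1` [set m])//.
  by apply: closed_comp; [move=> x _; exact: continuous_dotr|exact: closed_eq].
have cL : compact L.
  by apply: (@subclosed_compact _ _ K) => //; [exact: closedI|move=> x []].
have cv := continuous_subspaceT (@continuous_dotr v).
have [p] := @compact_EVT_min _ _ (dot v) L L0 cL (cv _).
rewrite inE => -[Kp pm] Hp.
have [q] := @compact_EVT_max _ _ (dot v) L L0 cL (cv _).
rewrite inE => -[Kq qm] Hq.
(* Otherwise [L] would continue past [p] in direction [- v]. *)
have Np : ~ K° p.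
  move=> /(interior_translate K p v v1)[e e0 /(_ (- e))].
  rewrite normrN gtr0_norm// => /(_ (lexx _)) Ke.
  have := Hp (p + (- e) *: v); rewrite inE vv => /(_ _).
  by move=> /(_ (conj Ke (etrans (uv _ _) pm))); lra.
have Nq : ~ K° q.
  move=> /(interior_translate K q v v1)[e e0 /(_ e)].
  rewrite gtr0_norm// => /(_ (lexx _)) Ke.
  have := Hq (q + e *: v); rewrite inE vv => /(_ _).
  by move=> /(_ (conj Ke (etrans (uv _ _) qm))); lra.
have Lz0 : z0 \in L by rewrite inE; split => //; exact: interior_subset.
have pz : dot v p < dot v z0.
  rewrite lt_neqAle Hp// andbT; apply/eqP => E.
  by apply: Np; rewrite (frame_inj u p z0 u1)//; rewrite pm z0m.
have zq : dot v z0 < dot v q.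
  rewrite lt_neqAle Hq// andbT; apply/eqP => E.
  by apply: Nq; rewrite (frame_inj u q z0 u1)//; rewrite qm z0m.
pose l (t : R) : plane := ((1 + t) / 2) *: q + (1 - (1 + t) / 2) *: p.
have lm t : dot u (l t) = m by rewrite /l dotDr !dotZr qm pm; ring.
have lv t : dot v (l t) = dot v p + (1 + t) / 2 * (dot v q - dot v p).
  by rewrite /l dotDr !dotZr; ring.
have lK t : -1 <= t <= 1 -> K (l t).
  by move=> t1; apply: (proj1 (convex_setP K)) => //; lra.
have cl : continuous l.
  move=> t; apply: cvgD.
    apply: cvgZ; last exact: cvg_cst.
    apply: cvgM; last exact: cvg_cst.
    by apply: cvgD; [exact: cvg_cst|exact: cvg_id].
  apply: cvgZ; last exact: cvg_cst.
  apply: cvgB; first exact: cvg_cst.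
  apply: cvgM; last exact: cvg_cst.
  by apply: cvgD; [exact: cvg_cst|exact: cvg_id].
(* Such a point lies on the segment from [z0] to one of the ends [p], [q], short of that end. *)
have lI t : -1 < t < 1 -> K° (l t).
  move=> t1; have [h|h] := leP (dot v (l t)) (dot v z0).
    pose s := (dot v (l t) - dot v p) / (dot v z0 - dot v p).
    have -> : l t = s *: z0 + (1 - s) *: p.
      apply: (frame_inj u) => //; first by rewrite lm dotDr !dotZr z0m pm; ring.
      by rewrite -/v [RHS]dotDr !dotZr /s; field; lra.
    apply: interior_conv => //; rewrite /s divr_gt0 ?ler_pdivrMr ?mul1r ?lerB//; last by lra.
      by rewrite subr_gt0.
    rewrite lv addrC addKr mulr_gt0//; lra.
  pose s := (dot v q - dot v (l t)) / (dot v q - dot v z0).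
  have -> : l t = s *: z0 + (1 - s) *: q.
    apply: (frame_inj u) => //; first by rewrite lm dotDr !dotZr z0m qm; ring.
    by rewrite -/v [RHS]dotDr !dotZr /s; field; lra.
  apply: interior_conv => //; rewrite /s divr_gt0 ?ler_pdivrMr ?mul1r ?lerB//; try lra.
  - by rewrite lv; nra.
exists (K `&` [set x | dot u x <= m]), (K `&` [set x | m <= dot u x]).
exists u, a, m, b; split => //; last 3 first.
- by move=> x [/KS/andP[-> _] /= ->].
- by move=> x [/KS/andP[_ ->] /= ->].
- by rewrite /m /b -/w; split; lra.
split.
- apply: closedI => //; rewrite (_ : [set _ | _] = dot u @^-1` [set x | x <= m])//.
  by apply: closed_comp; [move=> x _; exact: continuous_dotr|exact: closed_le].
- apply: closedI => //; rewrite (_ : [set _ | _] = dot u @^-1` [set x | m <= x])//.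
  by apply: closed_comp; [move=> x _; exact: continuous_dotr|exact: closed_ge].
- apply/seteqP; split=> [x Kx|x []]; last by move=> [].
  by have [h|/ltW h] := leP (dot u x) m; [left|right].
- by move=> [].
exists l; split.
- exact: continuous_subspaceT.
- move=> s t _ _ /(congr1 (dot v)); rewrite !lv => /addrI/mulIf.
  by move=> /(_ ltac:(lra)); lra.
- by move=> _ [t /= t1 <-]; apply: lK; rewrite in_itv in t1.
- move=> t; rewrite in_itv/= => t1; rewrite /boundary.
  have -> : closure K = K by apply/esym/closure_id.
  split=> [[_ NI]|].
    have [->|nt] := eqVneq t (-1); first by left.
    have [->|nt'] := eqVneq t 1; first by right.
    case: NI; apply: lI; move/andP: t1 => [h1 h2].
    by rewrite lt_neqAle eq_sym nt h1 lt_neqAle nt' h2.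
  move=> [->|->]; split=> /=; rewrite ?in_itv/=.
  - by apply: lK; lra.
  - by rewrite /l subrr mul0r scale0r add0r subr0 scale1r.
  - by apply: lK; lra.
  - by rewrite /l (_ : (1 + 1) / 2 = 1) ?subrr ?scale0r ?addr0 ?scale1r//; field.
- apply/seteqP; split=> [x [[Kx xm] [_ mx]]|_ [t /= t1 <-]].
    have {}xm : dot u x = m by apply/eqP; rewrite eq_le; apply/andP.
    have Lx : x \in L by rewrite inE.
    pose s := (dot v x - dot v p) / (dot v q - dot v p) * 2 - 1.
    exists s.
      rewrite /= in_itv/=; have := Hp _ Lx; have := Hq _ Lx => h1 h2.
      have : 0 <= (dot v x - dot v p) / (dot v q - dot v p) <= 1.
        by rewrite divr_ge0 ?ler_pdivrMr; lra.
      by rewrite /s; lra.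
    apply: (frame_inj u) => //; first by rewrite lm.
    by rewrite -/v lv /s; field; lra.
  by rewrite in_itv/= in t1; split; split => /=; rewrite ?lm//; exact: lK.
Qed.

Lemma bisecting_widthE (K : set plane) : convex_body K ->
  bisecting_width K = width K / 2.
Proof.
move=> bK; have [cK vK [z Kz]] := bK.
have K0 : K !=set0 by exists z; exact: interior_subset.
have [K1 [K2 [u [a [m [b [B u1 S1 S2 [am mb Ea Eb]]]]]]]] := midline_bisection K bK.
apply/eqP; rewrite eq_le; apply/andP; split.
  apply: (@le_trans _ _ (Num.max (width K1) (width K2))).
    apply: ge_inf; last by exists K1, K2.
    by exists 0 => _ [L1 [L2 [_ ->]]]; rewrite le_max width_ge0.
  rewrite ge_max -{1}Ea -Eb.
  by rewrite (width_le _ u)// (width_le _ u).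
apply: lb_le_inf; first by exists (Num.max (width K1) (width K2)), K1, K2.
move=> _ [L1 [L2 [[_ _ KL _] ->]]].
rewrite leNgt gt_max; apply/negP => /andP[h1 h2].
have L1K : L1 `<=` K by rewrite KL; exact: subsetUl.
have L2K : L2 `<=` K by rewrite KL; exact: subsetUr.
have [v1 [a1 [b1 [e1 ab1 T1 d1]]]] := width_lt _ _ _ cK L1K h1.
have [v2 [a2 [b2 [e2 ab2 T2 d2]]]] := width_lt _ _ _ cK L2K h2.
have := @width_le_two_planks K v1 a1 b1 v2 a2 b2 cK vK K0 e1 e2 ab1 ab2.
have KT x : K x -> a1 <= dot v1 x <= b1 \/ a2 <= dot v2 x <= b2.
  by rewrite {1}KL => -[/T1|/T2]; [left|right].
by move=> /(_ KT); lra.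
Qed.

Lemma width_gt0 (K : set plane) : convex_body K -> 0 < width K.
Proof.
move=> [cK vK [z Kz]].
have Kz' : K z by exact: interior_subset.
have K0 : K !=set0 by exists z.
have [u u1 <-] := width_attained K cK K0.
have [e e0 H] := interior_translate K z u u1 Kz.
have [HE _] := extentP K u cK K0.
have Ke : K (z + e *: u) by apply: H; rewrite gtr0_norm.
have := HE _ _ Ke Kz'; rewrite addrC addKr dotZr u1; lra.
Qed.

(** * Contact directions *)

Lemma continuous_affmap (a b c d e f : R) : continuous (affmap a b c d e f).
Proof.
have H (k l m : R) : continuous (fun x : plane => k * x.1 + l * x.2 + m : R).
  move=> x; apply: cvgD; last exact: cvg_cst.
  by apply: cvgD; apply: cvgM; solve [exact: cvg_cst|exact: cvg_fst|exact: cvg_snd].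
by move=> x; exact: (cvg_pair (H a b e x) (H c d f x)).
Qed.

Lemma compact_affmap (a b c d e f : R) (K : set plane) : compact K ->
  compact (affmap a b c d e f @` K).
Proof.
by apply: continuous_compact; apply: continuous_subspaceT; exact: continuous_affmap.
Qed.

Lemma convex_body_affmap (a b c d e f : R) (K : set plane) : a * d - b * c != 0 ->
  convex_body K -> convex_body (affmap a b c d e f @` K).
Proof.
move=> D0 [cK vK [z Kz]]; split; first exact: compact_affmap.
  apply/convex_setP => _ _ t t01 [x Kx <-] [y Ky <-].
  exists (t *: x + (1 - t) *: y); first by apply: (proj1 (convex_setP K)).
  rewrite [LHS]surjective_pairing [RHS]surjective_pairing /affmap.
  by congr pair; rewrite /= /GRing.scale /=; ring.
exists (affmap a b c d e f z); rewrite image_affmap// /interior.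
apply: continuous_affmap; rewrite (_ : affmap _ _ _ _ _ _ _ = z)//.
by rewrite [RHS]surjective_pairing /affmap; congr pair; rewrite /=; field.
Qed.

Lemma extent_affmap (a b c d e f : R) (K : set plane) u :
  extent (affmap a b c d e f @` K) u =
  extent K (a * u.1 + c * u.2, b * u.1 + d * u.2).
Proof.
rewrite /extent; congr sup; apply/seteqP; split=> r.
  move=> [[p q] [/= [x Kx <-] [y Ky <-]] <-]; exists (x, y) => //.
  by rewrite /dot /affmap /=; ring.
move=> [[x y] [/= Kx Ky] <-].
exists (affmap a b c d e f x, affmap a b c d e f y).
  by split; [exists x|exists y].
by rewrite /dot /affmap /=; ring.
Qed.

(** Areas scale by the determinant, so minimality of the ratio becomes an upper bound on the width
    of every affine image. The position enters the rest of the proof only in this form. *)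
Lemma position_width_le (a b c d e f : R) (K : set plane) : convex_body K ->
  isominwidth_bisecting_position K -> a * d - b * c != 0 ->
  width (affmap a b c d e f @` K) ^+ 2 <= `|a * d - b * c| * width K ^+ 2.
Proof.
move=> bK pK D0; have [cK _ Ki] := bK.
have bK' := @convex_body_affmap a b c d e f K D0 bK.
have w0 := width_gt0 K bK; have w0' := width_gt0 _ bK'.
have : isominwidth_ratio K <= isominwidth_ratio (affmap a b c d e f @` K).
  rewrite pK; apply: ge_inf.
    exists 0 => _ [phi _ <-]; rewrite /isominwidth_ratio divr_ge0 ?sqr_ge0//.
    by rewrite /area fine_ge0.
  by exists (affmap a b c d e f) => //; exists a, b, c, d, e, f.
rewrite /isominwidth_ratio !bisecting_widthE// area_affmap//.
have A0 := area_interior_gt0 K cK Ki.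
set w := width K in w0 *; set w' := width _ in w0' *.
rewrite ler_pdivrMr ?exprn_gt0 ?divr_gt0// mulrAC ler_pdivlMr ?exprn_gt0 ?divr_gt0//.
by rewrite -[leRHS]mulrA [leRHS]mulrCA ler_pM2l// => ?; lra.
Qed.

(* Otherwise stretching along [v] and shrinking across it by the same factor,
   which preserves areas, would increase the width. *)
Lemma position_contact (K : set plane) v : convex_body K ->
  isominwidth_bisecting_position K -> dot v v = 1 ->
  exists u, [/\ dot u u = 1, extent K u = width K & dot u v ^+ 2 <= 1 / 2].
Proof.
move=> bK pK v1; have [cK vK [z Kz]] := bK.
have K0 : K !=set0 by exists z; exact: interior_subset.
have w0 := width_gt0 K bK.
(* The directions at least 45 degrees away from the line of [v]. If none is a contact direction,
   compactness leaves a gap [h] between their extents and the width. *)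
pose A := [set u : plane | dot u u = 1] `&` [set u | dot u v ^+ 2 <= 1 / 2].
have A0 : A !=set0.
  exists (perp v); split; first exact: perp1.
  by rewrite /= (_ : dot _ _ = 0) ?expr0n ?divr_ge0//= /dot /=; ring.
have cA : compact A.
  apply: compact_circle.
  rewrite (_ : [set u | _] = (fun u => dot u v ^+ 2) @^-1` [set x | x <= 1 / 2])//.
  apply: closed_comp; last exact: closed_le.
  move=> u _; rewrite /dot; apply: (@cvgM _ _ (nbhs u)).
  - by apply: cvgD; apply: cvgM; solve [exact: cvg_cst|exact: cvg_fst|exact: cvg_snd].
  - by apply: cvgD; apply: cvgM; solve [exact: cvg_cst|exact: cvg_fst|exact: cvg_snd].
have [u] := @compact_EVT_min _ _ (extent K) A A0 cA
  (continuous_subspaceT (extent_continuous K cK K0)).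
rewrite inE => -[/= u1 uv] Hu.
have [E|NE] := eqVneq (extent K u) (width K); first by exists u.
pose h := extent K u - width K.
have h0 : 0 < h by rewrite subr_gt0 lt_neqAle eq_sym NE width_le_extent.
have [C C0 HC] := extent_lipschitz K cK K0.
(* The stretch by [1 + m] moves each coordinate of a unit vector by at most [2 * m], so extents
   change by at most [C * (4 * m) = h / 2]. *)
pose m := h / (8 * C); have m0 : 0 < m by rewrite divr_gt0// mulr_gt0.
pose l := 1 + m; have l1 : 1 < l by rewrite /l; lra.
have l0 : 0 < l by lra.
have l0' := lt0r_neq0 l0.
have li : 1 - l^-1 <= m by rewrite lerBlDr -lerBlDl -div1r ler_pdivlMr// /l; nra.
have li1 : l^-1 < 1 by rewrite invf_lt1.
have li0 : 0 < l^-1 by rewrite invr_gt0.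
(* The symmetric matrix with eigenvalue [l] on [v] and [l^-1] on [perp v]. *)
pose a := l * v.1 ^+ 2 + l^-1 * v.2 ^+ 2.
pose b := (l - l^-1) * v.1 * v.2.
pose d := l * v.2 ^+ 2 + l^-1 * v.1 ^+ 2.
have D1 : a * d - b * b = 1.
  rewrite /a /b /d; transitivity ((dot v v) ^+ 2); last by rewrite v1 expr1n.
  by rewrite /dot; field.
have := @position_width_le a b b d 0 0 K bK pK.
rewrite D1 normr1 mul1r => /(_ (oner_neq0 _)).
have bK' : convex_body (affmap a b b d 0 0 @` K).
  by apply: convex_body_affmap => //; rewrite D1 oner_neq0.
rewrite ler_sqr ?nnegrE ?width_ge0// => wle.
suff : width K < width (affmap a b b d 0 0 @` K) by rewrite ltNge wle.
have [cK' _ [z' Kz']] := bK'.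
have K0' : (affmap a b b d 0 0 @` K) !=set0 by exists z'; exact: interior_subset.
have [x x1 <-] := width_attained _ cK' K0'.
rewrite extent_affmap; set y := (_, _).
pose c := dot v x; pose s := dot (perp v) x.
have xv k : k = k * dot v v by rewrite v1 mulr1.
have yE : y = (x.1 + (l - 1) * c * v.1 - (1 - l^-1) * s * (perp v).1,
               x.2 + (l - 1) * c * v.2 - (1 - l^-1) * s * (perp v).2).
  rewrite /y /a /b /d /c /s; congr pair.
    rewrite [X in _ = X + _ - _]xv /dot /perp /=; ring.
  rewrite [X in _ = X + _ - _]xv /dot /perp /=; ring.
have yy : dot y y = l ^+ 2 * c ^+ 2 + l^-1 ^+ 2 * s ^+ 2.
  transitivity ((l ^+ 2 * c ^+ 2 + l^-1 ^+ 2 * s ^+ 2) * dot v v); last by rewrite v1 mulr1.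
  by rewrite /y /a /b /d /c /s /dot /=; ring.
have cs : c ^+ 2 + s ^+ 2 = 1.
  transitivity (dot v v * dot x x); last by rewrite v1 x1 mulr1.
  by rewrite /c /s /dot /=; ring.
(* Directions near [v] are lengthened, which raises their extent above the width; the remaining ones
   satisfy [c ^+ 2 <= s ^+ 2], hence lie in [A], where the gap [h] absorbs the change. *)
have [slc|lcs] := ltP (s ^+ 2) (l ^+ 2 * c ^+ 2).
  apply: lt_le_trans (extent_ge_norm K y cK K0).
  have n1 : 1 < dot y y.
    rewrite yy -cs -subr_gt0 [ltRHS](_ : _ = (1 - l^-1 ^+ 2) * (l ^+ 2 * c ^+ 2 - s ^+ 2)).
      by rewrite mulr_gt0 ?subr_gt0// expr_lt1// ltW.
    by field.
  by rewrite -[ltLHS]mulr1 ltr_pM2l// -sqrtr1 ltr_sqrt// (lt_trans ltr01).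
have xA : x \in A.
  rewrite inE; split => //=; rewrite (_ : dot x v = c); last by rewrite /c /dot; ring.
  have : c ^+ 2 <= l ^+ 2 * c ^+ 2 by rewrite ler_peMl ?sqr_ge0// expr_ge1// ltW.
  lra.
apply: lt_le_trans (_ : width K + h - C * (4 * m) <= _).
  rewrite /m (_ : _ * (4 * _) = h / 2); first by lra.
  by field; exact: lt0r_neq0.
rewrite lerBlDr; apply: (@le_trans _ _ (extent K x)).
  by rewrite /h addrC subrK Hu.
apply: le_trans (HC x y) _; rewrite lerD2l ler_pM2l//.
have [c1 s1] : `|c| <= 1 /\ `|s| <= 1 by rewrite !ler_norml; split; apply/andP; split; nra.
have [v11 v21] := unit_coord_le1 v v1.
have mm : 0 < 1 - l^-1 by rewrite subr_gt0.
have B (p q r r' : R) : `|p| <= 1 -> `|q| <= 1 -> `|r| <= 1 -> `|r'| <= 1 ->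
    `|(l - 1) * p * r - (1 - l^-1) * q * r'| <= 2 * m.
  move=> p1 q1 r1 r1'; apply: le_trans (ler_normB _ _) _.
  rewrite !normrM (gtr0_norm mm) [`|l - 1|]gtr0_norm ?subr_gt0//.
  have -> : 2 * m = m + m by ring.
  rewrite -!mulrA lerD//.
    rewrite (_ : l - 1 = m); last by rewrite /l; ring.
    by rewrite ler_piMr ?(ltW m0)// mulr_ile1.
  apply: le_trans li; rewrite ler_piMr ?(ltW mm)// mulr_ile1//.
have e1 : `|x.1 - y.1| <= 2 * m.
  rewrite distrC (_ : y.1 - x.1 = (l - 1) * c * v.1 - (1 - l^-1) * s * (- v.2)).
    by apply: B; rewrite ?normrN.
  by rewrite yE /perp /=; ring.
have e2 : `|x.2 - y.2| <= 2 * m.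
  rewrite distrC (_ : y.2 - x.2 = (l - 1) * c * v.2 - (1 - l^-1) * s * v.1).
    exact: B.
  by rewrite yE /perp /=; ring.
lra.
Qed.

(** * Areas of hexagons *)

Lemma area_union_le (A B : set plane) : compact A -> compact B ->
  area (A `|` B) <= area A + area B.
Proof.
move=> cA cB; rewrite -lee_fin EFinD -!area_leb2//; last exact: compactU.
by apply: measureU2; exact: compact_measurable_plane.
Qed.

Lemma area_set0 : area (set0 : set plane) = 0.
Proof. by rewrite /area measure0. Qed.

Definition triangle : set plane :=
  [set x | [/\ 0 <= x.1, 0 <= x.2 & x.1 + x.2 <= 1]].

Lemma compact_triangle : compact triangle.
Proof.
apply: (@subclosed_compact _ _ (box 0 1 0 1)); last 2 first.
- exact: compact_box.
- by move=> x [? ? ?]; split; rewrite /= in_itv/=; lra.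
rewrite (_ : triangle = (fst @^-1` [set r | 0 <= r] `&` snd @^-1` [set r | 0 <= r])
  `&` (fun x : plane => x.1 + x.2) @^-1` [set r | r <= 1]); last first.
  by apply/seteqP; split=> [x []|x [[]]].
apply: closedI; first apply: closedI.
- by apply: closed_comp; [move=> x _; exact: cvg_fst|exact: closed_ge].
- by apply: closed_comp; [move=> x _; exact: cvg_snd|exact: closed_ge].
- apply: closed_comp; last exact: closed_le.
  by move=> x _; apply: cvgD; [exact: cvg_fst|exact: cvg_snd].
Qed.

(** The triangle and its reflection in the centre of the unit square cover the square. *)
Lemma area_triangle_ge : 1 / 2 <= area triangle.
Proof.
have ct := compact_triangle.
have : area (box 0 1 0 1) <= area (triangle `|` affmap (-1) 0 0 (-1) 1 1 @` triangle).
  apply: area_le; first exact: measurable_box.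
    by apply: compactU => //; exact: compact_affmap.
  move=> x [/=]; rewrite !in_itv/= => x1 x2.
  have [h|h] := leP (x.1 + x.2) 1; [left|right]; first by split; lra.
  exists (1 - x.1, 1 - x.2); first by split=> /=; lra.
  by rewrite /affmap /= [RHS]surjective_pairing; congr pair; ring.
move=> /le_trans/(_ (area_union_le _ _ ct (compact_affmap _ _ _ _ _ _ _ ct))).
have D : (-1) * (-1) - 0 * 0 = 1 :> R by ring.
rewrite area_affmap ?D ?oner_neq0// area_box// normr1; lra.
Qed.

(* The factor [9/10] makes room for the strict inequality. *)
Lemma corner (a b t : R) : 0 < a -> 0 < b -> 0 <= t ->
  exists S : set plane, [/\ compact S,
    forall x, S x -> [/\ 0 <= x.1, 0 <= x.2 & a * x.1 + b * x.2 < t]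
    & 81 / 100 * (t ^+ 2 / (2 * a * b)) <= area S].
Proof.
move=> a0 b0 t0; have [->|tn0] := eqVneq t 0.
  exists set0; split; [exact: compact0|by []|].
  by rewrite area_set0 expr0n /= mul0r mulr0.
have {t0 tn0}t0 : 0 < t by rewrite lt_neqAle eq_sym tn0.
have a0' := lt0r_neq0 a0; have b0' := lt0r_neq0 b0.
pose p := 9 / 10 * t / a; pose q := 9 / 10 * t / b.
have p0 : 0 < p by rewrite divr_gt0//; lra.
have q0 : 0 < q by rewrite divr_gt0//; lra.
exists (affmap p 0 0 q 0 0 @` triangle); split.
- exact: compact_affmap compact_triangle.
- move=> _ [x [x1 x2 x12] <-] /=; rewrite !mul0r !addr0 add0r; split.
  + by rewrite mulr_ge0// ltW.
  + by rewrite mulr_ge0// ltW.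
  + rewrite (_ : _ + _ = 9 / 10 * t * (x.1 + x.2)); last by rewrite /p /q; field; exact/andP.
    by nra.
have D : p * q - 0 * 0 = p * q by ring.
have pq0 : 0 < p * q by rewrite mulr_gt0.
rewrite area_affmap ?D ?(lt0r_neq0 pq0)//; last exact: compact_triangle.
rewrite (gtr0_norm pq0).
apply: (@le_trans _ _ (p * q * (1 / 2))); last first.
  by apply: ler_wpM2l area_triangle_ge; rewrite ltW.
by rewrite le_eqVlt; apply/orP; left; apply/eqP; rewrite /p /q; field; exact/andP.
Qed.

(** [S] misses the corners of the square at (0, 0) and (1, 1) cut off by the strip, right triangles
    of areas [t ^+ 2 / (2 * a * b)] and [(a + b - 1 - t) ^+ 2 / (2 * a * b)]. By convexity their sum
    is least when the strip is centred. *)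
Lemma area_hexagon_le (a b t : R) (S : set plane) : compact S ->
  0 < a <= 1 -> 0 < b <= 1 -> 0 <= t <= a + b - 1 -> S `<=` box 0 1 0 1 ->
  (forall x, S x -> t <= a * x.1 + b * x.2 <= t + 1) ->
  area S <= 1 - 81 / 100 * ((a + b - 1) ^+ 2 / (4 * a * b)).
Proof.
move=> cS /andP[a0 a1] /andP[b0 b1] /andP[t0 tab] SB St.
have [T1 [cT1 HT1 A1]] := corner a b t a0 b0 t0.
have [|T2 [cT2 HT2 A2]] := corner a b (a + b - 1 - t) a0 b0; first by lra.
move: A1 A2.
pose T3 := affmap (-1) 0 0 (-1) 1 1 @` T2.
have cT3 : compact T3 by exact: compact_affmap.
have A3 : area T3 = area T2.
  have D : (-1) * (-1) - 0 * 0 = 1 :> R by ring.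
  by rewrite area_affmap ?D ?oner_neq0// normr1 mul1r.
have HT3 x : T3 x -> [/\ x.1 <= 1, x.2 <= 1 & t + 1 < a * x.1 + b * x.2].
  by move=> [y /HT2[y1 y2 y3] <-]; rewrite /affmap /=; split; lra.
have in_unit (x c : R) : 0 < c <= 1 -> c * x <= c -> x <= 1.
  by move=> /andP[c0 _]; rewrite -[leRHS]mulr1 ler_pM2l.
have in_unit' (x c : R) : 0 < c <= 1 -> c * (1 - x) <= c -> 0 <= x.
  by move=> c01 /in_unit -/(_ c01); lra.
have ST1 : S `&` T1 = set0.
  by rewrite -subset0 => x [/St/andP[h _] /HT1[_ _]]; rewrite ltNge h.
have cST1 : compact (S `|` T1) by exact: compactU.
have e1 : area S + area T1 <= area (S `|` T1) by exact: area_disjoint_le.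
move: A3 e1.
have e2 : area (S `|` T1) + area T3 <= area (box 0 1 0 1).
  apply: area_disjoint_le => //; first exact: compact_box.
    rewrite -subset0 => x [[/St/andP[_ h]|/HT1[_ _ h]] /HT3[_ _]].
      by rewrite ltNge h.
    by rewrite ltNge (le_trans (ltW h))// lerDl.
  (* The triangles fit into the square: [t] and [a + b - 1 - t] are at most [a + b - 1], which is at
     most [a] and at most [b]. *)
  move=> x [[/SB//|/HT1[x1 x2 x3]]|[y /HT2[y1 y2 y3] <-]]; split; rewrite /= in_itv/=;
    apply/andP; split => //.
  - by apply: (in_unit _ a); [rewrite a0|nra].
  - by apply: (in_unit _ b); [rewrite b0|nra].
  - rewrite mul0r addr0; apply: (in_unit' _ a); first by rewrite a0.
    by rewrite (_ : 1 - _ = y.1); [nra|ring].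
  - by lra.
  - rewrite mul0r add0r; apply: (in_unit' _ b); first by rewrite b0.
    by rewrite (_ : 1 - _ = y.2); [nra|ring].
  - by lra.
move: e2; rewrite area_box// subr0 mulr1 => e2 A3 e1 A1 A2; rewrite A3 in e2.
have ab0 : 0 < 2 * a * b by rewrite !mulr_gt0.
suff : (a + b - 1) ^+ 2 / (4 * a * b) <=
  t ^+ 2 / (2 * a * b) + (a + b - 1 - t) ^+ 2 / (2 * a * b) by lra.
move=> {A1 A2 A3 e1 e2}; rewrite -mulrDl.
rewrite [leLHS](_ : _ = (a + b - 1) ^+ 2 / 2 / (2 * a * b)); last first.
  by field; rewrite !gt_eqF.
rewrite ler_pM2r ?invr_gt0//.
have := sqr_ge0 (a + b - 1 - 2 * t); rewrite !expr2; nra.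
Qed.

(* Applied to [d = - dot u1 u2], where [u1], [u2] and [a u1 + b u2] are unit
   vectors. *)
Lemma hexagon_bound (a b d : R) : 0 < a <= 1 -> 0 < b <= 1 -> 1 < a + b -> 0 <= d ->
  a ^+ 2 + b ^+ 2 - 2 * a * b * d = 1 ->
  (1 - 81 / 100 * ((a + b - 1) ^+ 2 / (4 * a * b))) ^+ 2 < 1 - d ^+ 2.
Proof.
move=> /andP[a0 a1] /andP[b0 b1] ab d0 E.
have p0 : 0 < a * b by rewrite mulr_gt0.
set X := _ / (4 * a * b).
have EX : 4 * (a * b) * X = (a + b - 1) ^+ 2.
  by rewrite /X; field; rewrite !gt_eqF.
have q0 : 0 <= (1 - a) * (1 - b) by rewrite mulr_ge0//; lra.
have X0 : 0 < X.
  by rewrite /X divr_gt0 ?exprn_gt0 ?mulr_gt0//; lra.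
have X4 : X <= 1 / 4.
  rewrite -(ler_pM2l (_ : 0 < 4 * (a * b))) ?EX; last by lra.
  have : a + b - 1 <= a * b by nra.
  have : a * b <= 1 by nra.
  nra.
(* Multiplied by [2 * (a * b)], with [d] eliminated through [E], the two sides differ by
   [2 * ((1 - a) * (1 - b))]. *)
have dX : d <= 2 * X.
  rewrite -(ler_pM2l (_ : 0 < 2 * (a * b))); last by lra.
  have -> : 2 * (a * b) * (2 * X) = 4 * (a * b) * X by ring.
  by rewrite EX !expr2 in E *; nra.
(* [d ^+ 2 <= 4 * X ^+ 2 <= X]. What remains is [(1 - 81 / 100 * X) ^+ 2 < 1 - X], true since the
   linear term is -1.62 X and [X <= 1 / 4]. *)
have : d ^+ 2 <= X by rewrite expr2; nra.
rewrite !expr2; nra.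
Qed.

(** * Bodies in position *)

(** A closed set that misses a point of the box misses a smaller box of positive area. *)
Lemma box_eq_of_area (a b c d : R) (S : set plane) : compact S -> a < b -> c < d ->
  S `<=` box a b c d -> (b - a) * (d - c) <= area S -> S = box a b c d.
Proof.
move=> cS ab cd SB A; apply/seteqP; split => // y [/=]; rewrite !in_itv/= => y1 y2.
apply/not_notP => NSy.
have oS : open (~` S) by apply: closed_openC; exact: (compact_closed hausdorff_plane).
have : (~` S)° y by have -> : (~` S)° = ~` S by apply/interior_id.
move=> /interior_box[e e0 H].
(* The missed point may lie on the edge of the box, so the neighbourhood is clipped to the box. *)
have I (p q z : R) : p < q -> p <= z <= q -> exists p' q',
    [/\ p <= p', p' < q', q' <= q, z - e < p' & q' < z + e].
  move=> pq /andP[pz zq].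
  exists (Num.max p (z - e / 2)), (Num.min q (z + e / 2)); split.
  - by rewrite le_max lexx.
  - by rewrite gt_max !lt_min pq; apply/andP; split; apply/andP; split => //; lra.
  - by rewrite ge_min lexx.
  - by rewrite lt_max; apply/orP; right; lra.
  - by rewrite gt_min; apply/orP; right; lra.
have [p1 [q1 [h1 h2 h3 h4 h5]]] := I _ _ _ ab y1.
have [p2 [q2 [k1 k2 k3 k4 k5]]] := I _ _ _ cd y2.
have : area S + area (box p1 q1 p2 q2) <= area (box a b c d).
  apply: area_disjoint_le => //; try exact: compact_box.
    rewrite -subset0 => x [Sx [/=]]; rewrite !in_itv/= => x1 x2.
    by case: (H x) => //; rewrite ltr_norml; lra.
  move=> x [/SB//|[/=]]; rewrite !in_itv/= => x1 x2.
  by split; rewrite /= in_itv/=; lra.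
rewrite !area_box; try lra.
have : 0 < (q1 - p1) * (q2 - p2) by rewrite mulr_gt0// subr_gt0.
lra.
Qed.

Lemma dotC (u v : plane) : dot u v = dot v u.
Proof. by rewrite /dot; ring. Qed.

Lemma dotBr (u x y : plane) : dot u (x - y) = dot u x - dot u y.
Proof. by rewrite /dot /=; ring. Qed.

Lemma dotNl (u v : plane) : dot (- u) v = - dot u v.
Proof. by rewrite /dot /=; ring. Qed.

(** Lagrange's identity, cos^2 + sin^2 = 1 for unit vectors: it converts bounds on dot products into
    bounds on determinants. *)
Lemma dot_detE (u v : plane) :
  dot u v ^+ 2 + (u.1 * v.2 - u.2 * v.1) ^+ 2 = dot u u * dot v v.
Proof. by rewrite /dot; ring. Qed.

(** The coordinates [dot u1], [dot u2] are an isometry that turns the intersection of the strips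
    into a box of side [w]; equality of areas makes [K] fill it. *)
Lemma orthogonal_strips (K : set plane) u1 u2 a1 a2 w : compact K ->
  0 < w -> dot u1 u1 = 1 -> dot u2 u2 = 1 -> dot u1 u2 = 0 ->
  (forall x, K x -> a1 <= dot u1 x <= a1 + w) ->
  (forall x, K x -> a2 <= dot u2 x <= a2 + w) ->
  area K <= w ^+ 2 /\ (area K = w ^+ 2 -> is_square K).
Proof.
move=> cK w0 e1 e2 e12 S1 S2.
pose D := u1.1 * u2.2 - u1.2 * u2.1.
have D2 : D ^+ 2 = 1.
  by have := dot_detE u1 u2; rewrite e1 e2 e12 expr0n add0r mulr1.
have D0 : D != 0 by apply: contra_eq_neq D2 => ->; rewrite expr0n/= eq_sym oner_neq0.
have Dn : `|D| = 1.
  by apply/eqP; rewrite -(eqrXn2 (ltn0Sn 1)) ?normr_ge0// real_normK ?num_real// D2 expr1n.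
pose psi := affmap u1.1 u1.2 u2.1 u2.2 0 0.
have psiE x : psi x = (dot u1 x, dot u2 x) by rewrite /psi /affmap !addr0.
have cpsi : compact (psi @` K) by exact: compact_affmap.
have KB : psi @` K `<=` box a1 (a1 + w) a2 (a2 + w).
  by move=> _ [x Kx <-]; rewrite psiE; split; rewrite /= in_itv/= ?S1 ?S2.
have AE : area (psi @` K) = area K by rewrite area_affmap// -/D Dn mul1r.
have AB : area (box a1 (a1 + w) a2 (a2 + w)) = w ^+ 2.
  by rewrite area_box ?lerDl ?(ltW w0)// !(addrC _ w) !addrK expr2.
split.
  by rewrite -AE -AB; apply: area_le => //; [exact: compact_measurable_plane|exact: compact_box].
move=> Aw.
have EB : psi @` K = box a1 (a1 + w) a2 (a2 + w).
  by apply: box_eq_of_area; rewrite ?ltrDl// AE Aw !(addrC _ w) !addrK expr2.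
have psi_inj x y : psi x = psi y -> x = y.
  rewrite !psiE => -[h1 h2].
  have E z : z = ((u2.2 * dot u1 z - u1.2 * dot u2 z) / D,
    (u1.1 * dot u2 z - u2.1 * dot u1 z) / D).
    by rewrite [LHS]surjective_pairing /dot; congr pair; rewrite /D; field.
  by rewrite (E x) (E y) h1 h2.
pose p := a1 *: u1 + a2 *: u2.
exists p, (w *: u1), (w *: u2).
have dE (s t : R) : let x := p + s *: (w *: u1) + t *: (w *: u2) in
    (dot u1 x = a1 + s * w) /\ (dot u2 x = a2 + t * w).
  by rewrite /p !dotDr !dotZr e1 e2 (dotC u2 u1) e12; split; ring.
split.
- apply/eqP => E; have : dot (w *: u1) (w *: u1) = 0 by rewrite E /dot /=; ring.
  by rewrite dotZr dotC dotZr e1 mulr1 => /eqP; rewrite mulf_eq0 (gt_eqF w0).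
- by rewrite dotZr dotC dotZr (dotC u2 u1) e12 !mulr0.
- by rewrite !dotZr ![dot (w *: _) _]dotC !dotZr e1 e2.
- apply/seteqP; split=> [x Kx|x [s [t [s01 t01 ->]]]] /=.
    have /andP[x1 x1'] := S1 _ Kx; have /andP[x2 x2'] := S2 _ Kx.
    exists ((dot u1 x - a1) / w), ((dot u2 x - a2) / w); split.
    + by rewrite divr_ge0 ?ler_pdivrMr//; lra.
    + by rewrite divr_ge0 ?ler_pdivrMr//; lra.
    + apply: psi_inj; rewrite !psiE.
      have [-> ->] := dE ((dot u1 x - a1) / w) ((dot u2 x - a2) / w).
      by congr pair; field; exact: lt0r_neq0.
  have [E1 E2] := dE s t.
  have : (psi @` K) (psi (p + s *: (w *: u1) + t *: (w *: u2))).
    by rewrite EB psiE E1 E2; split; rewrite /= in_itv/=; nra.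
  by move=> [y Ky /psi_inj <-].
Qed.

(* In the coordinates [dot u1] and [dot u2], scaled so that two of the strips
   form the unit square, the third strip cuts off two corners. *)
Lemma hexagon_strips (K : set plane) u1 u2 u3 a b : compact K -> K !=set0 ->
  0 < width K -> dot u1 u1 = 1 -> dot u2 u2 = 1 -> dot u3 u3 = 1 ->
  extent K u1 = width K -> extent K u2 = width K -> extent K u3 = width K ->
  dot u1 u2 <= 0 -> u3 = a *: u1 + b *: u2 -> 0 < a <= 1 -> 0 < b <= 1 ->
  dot u1 u2 ^+ 2 < 1 -> area K < width K ^+ 2.
Proof.
move=> cK K0; set w := width K => w0 e1 e2 e3 x1 x2 x3 d0 u3E a01 b01 d1.
have w0' := lt0r_neq0 w0.
have [a1 S1] := extent_strip K u1 cK K0; rewrite x1 -/w in S1.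
have [a2 S2] := extent_strip K u2 cK K0; rewrite x2 -/w in S2.
have [H3 [y [z [Ky Kz E3]]]] := extentP K u3 cK K0.
rewrite x3 in H3 E3.
pose D := u1.1 * u2.2 - u1.2 * u2.1.
have D2 : D ^+ 2 = 1 - dot u1 u2 ^+ 2.
  by have := dot_detE u1 u2; rewrite e1 e2 mulr1 -/D => <-; ring.
have D20 : 0 < D ^+ 2 by rewrite D2; lra.
have D0 : D != 0 by apply: contraTneq D20 => ->; rewrite expr0n/= ltxx.
pose psi := affmap (u1.1 / w) (u1.2 / w) (u2.1 / w) (u2.2 / w) (- a1 / w) (- a2 / w).
have psiE x : psi x = ((dot u1 x - a1) / w, (dot u2 x - a2) / w).
  by rewrite /psi /affmap /dot; congr pair; field.
have Dw : u1.1 / w * (u2.2 / w) - u1.2 / w * (u2.1 / w) = D / w ^+ 2.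
  by rewrite /D; field.
(* The offset of the third strip in the rescaled coordinates, where it reads
   [s <= a * x.1 + b * x.2 <= s + 1]. *)
pose s := (dot u3 z - a * a1 - b * a2) / w.
have sE x : a * ((dot u1 x - a1) / w) + b * ((dot u2 x - a2) / w) =
    s + (dot u3 x - dot u3 z) / w.
  by rewrite /s u3E /dot /= /GRing.scale /=; field.
have S3 x : K x -> 0 <= (dot u3 x - dot u3 z) / w <= 1.
  move=> Kx; move: (H3 _ _ Kx Kz) (H3 _ _ Ky Kx) E3; rewrite -/w !dotBr => h1 h2 h3.
  by rewrite divr_ge0 ?ler_pdivrMr ?(ltW w0)// ?mul1r //; lra.
have in01 (c r : R) : c <= r <= c + w -> 0 <= (r - c) / w <= 1.
  move=> h; rewrite divr_ge0 ?ler_pdivrMr ?(ltW w0)//; lra.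
have [a0 _] := andP a01; have [b0 _] := andP b01.
(* [z] and [y] lie on the two sides of the third strip and are mapped into the unit square, on which
   the form with coefficients [a], [b] ranges from 0 to [a + b]. *)
have s0 : 0 <= s <= a + b - 1.
  have /andP[z1 z1'] := in01 _ _ (S1 _ Kz); have /andP[z2 z2'] := in01 _ _ (S2 _ Kz).
  have /andP[y1 y1'] := in01 _ _ (S1 _ Ky); have /andP[y2 y2'] := in01 _ _ (S2 _ Ky).
  have := sE z; rewrite subrr mul0r addr0 => <-.
  have := sE y; rewrite (_ : (dot u3 y - dot u3 z) / w = 1).
    2: by rewrite -dotBr -E3 divff.
  have : 0 <= a * ((dot u1 z - a1) / w) by rewrite mulr_ge0// ltW.
  have : 0 <= b * ((dot u2 z - a2) / w) by rewrite mulr_ge0// ltW.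
  have : a * ((dot u1 y - a1) / w) <= a by rewrite ler_piMr// ltW.
  have : b * ((dot u2 y - a2) / w) <= b by rewrite ler_piMr// ltW.
  have := sE z; rewrite subrr mul0r addr0.
  lra.
have EE : a ^+ 2 + b ^+ 2 - 2 * a * b * (- dot u1 u2) = 1.
  rewrite -[RHS]e3 u3E.
  transitivity (a ^+ 2 * dot u1 u1 + b ^+ 2 * dot u2 u2 + 2 * a * b * dot u1 u2).
    by rewrite e1 e2; ring.
  by rewrite /dot /= /GRing.scale /=; ring.
have ab1 : 1 < a + b.
  have p0 : 0 < a * b by rewrite mulr_gt0.
  have : 0 < a * b * (1 - dot u1 u2) by rewrite mulr_gt0//; lra.
  have : (a + b) ^+ 2 = 1 + 2 * (a * b * (1 - dot u1 u2)).
    by rewrite -[X in _ = X + _]EE; ring.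
  by rewrite expr2; nra.
have := @hexagon_bound a b (- dot u1 u2) a01 b01 ab1 _ EE.
rewrite oppr_ge0 => /(_ d0); rewrite sqrrN -D2.
have cpsi : compact (psi @` K) by exact: compact_affmap.
have KB : psi @` K `<=` box 0 1 0 1.
  by move=> _ [x Kx <-]; rewrite psiE; split; rewrite /= in_itv/= in01 ?S1 ?S2.
have := @area_hexagon_le a b s _ cpsi a01 b01 s0 KB.
have St x : (psi @` K) x -> s <= a * x.1 + b * x.2 <= s + 1.
  by move=> [z' Kz' <-]; rewrite psiE sE; have := S3 _ Kz'; lra.
have -> : area (psi @` K) = `|D| / w ^+ 2 * area K.
  have DD : u1.1 / w * (u2.2 / w) - u1.2 / w * (u2.1 / w) != 0.
    by rewrite Dw mulf_neq0// invr_eq0 expf_neq0.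
  rewrite (area_affmap _ _ _ _ (- a1 / w) (- a2 / w) _ DD cK) Dw.
  by rewrite normrM normfV (gtr0_norm (exprn_gt0 2 w0)).
move=> /(_ St) A1 A2.
have {A2} : 1 - 81 / 100 * ((a + b - 1) ^+ 2 / (4 * a * b)) < `|D|.
  rewrite ltNge; apply/negP => h; move: A2; rewrite ltNge => /negP; apply.
  by rewrite -(real_normK (num_real D)) ler_sqr ?nnegrE// (le_trans _ h).
move=> /(le_lt_trans A1); rewrite mulrAC ltr_pdivrMr ?exprn_gt0// ltr_pM2l//.
by rewrite normr_gt0.
Qed.

(** By Cramer's rule [a] and [b] are quotients of sines, and [u1], [u2] form the pair with the
    largest sine; hence the bounds by 1. The last hypothesis keeps [u3] at least 45 degrees from the
    line of [u1 - u2], since half the squared norm of [u1 - u2] is [1 - dot u1 u2]; it decides the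
    sign of [a * b]. *)
Lemma contact_triple (u1 u2 u3 : plane) : dot u1 u1 = 1 -> dot u2 u2 = 1 ->
  dot u3 u3 = 1 -> dot u1 u2 < 0 ->
  dot u1 u2 ^+ 2 <= dot u1 u3 ^+ 2 -> dot u1 u2 ^+ 2 <= dot u2 u3 ^+ 2 ->
  dot u3 (u1 - u2) ^+ 2 <= 1 - dot u1 u2 ->
  dot u1 u2 ^+ 2 < 1 /\
  exists a b, [/\ u3 = a *: u1 + b *: u2, 0 < a * b, a ^+ 2 <= 1 & b ^+ 2 <= 1].
Proof.
move=> e1 e2 e3 d0 m13 m23 H.
pose c := dot u1 u2; rewrite -/c in d0 m13 m23 H *.
pose D := u1.1 * u2.2 - u1.2 * u2.1.
have D2 : D ^+ 2 = 1 - c ^+ 2.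
  by have := dot_detE u1 u2; rewrite e1 e2 mulr1 -/D -/c => <-; ring.
have D13 := dot_detE u1 u3; have D23 := dot_detE u2 u3.
rewrite e1 e3 mulr1 in D13; rewrite e2 e3 mulr1 in D23.
(* If [u2 = - u1], minimality makes [u3] parallel to [u1], hence to [u1 - u2], which the 45 degrees
   exclude. *)
have D0 : D != 0.
  apply/eqP => D0; have c1 : c ^+ 2 = 1 by have := D2; rewrite D0 expr0n/=; lra.
  have cm : c = - 1 by rewrite expr2 in c1; nra.
  have u2E : u2 = - u1.
    have : dot (u2 + u1) (u2 + u1) = 0.
      rewrite (_ : dot _ _ = dot u1 u1 + dot u2 u2 + 2 * c); last by rewrite /c /dot /=; ring.
      by rewrite e1 e2 cm; ring.
    rewrite /dot => /eqP; rewrite paddr_eq0 -?expr2 ?sqr_ge0// !sqrf_eq0 /=.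
    move=> /andP[/eqP h1 /eqP h2].
    by rewrite [LHS]surjective_pairing [RHS]surjective_pairing; congr pair => /=; lra.
  have : 1 <= dot u1 u3 ^+ 2 by rewrite -c1.
  move: H; rewrite u2E opprK dotDr (dotC u3) cm !expr2; nra.
have c1 : c ^+ 2 < 1.
  by rewrite -subr_gt0 -D2 lt_neqAle sqr_ge0 andbT eq_sym expf_neq0.
split=> //.
pose a := (u3.1 * u2.2 - u3.2 * u2.1) / D.
pose b := (u1.1 * u3.2 - u1.2 * u3.1) / D.
have u3E : u3 = a *: u1 + b *: u2.
  rewrite [LHS]surjective_pairing [RHS]surjective_pairing /a /b /D; congr pair;
    by rewrite /= /GRing.scale /=; field.
have D2p : 0 < D ^+ 2 by rewrite D2; lra.
have a2 : a ^+ 2 <= 1.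
  rewrite /a expr_div_n ler_pdivrMr// mul1r D2.
  by rewrite [leLHS](_ : _ = 1 - dot u2 u3 ^+ 2); [lra|rewrite -D23; ring].
have b2 : b ^+ 2 <= 1.
  rewrite /b expr_div_n ler_pdivrMr// mul1r D2.
  by rewrite [leLHS](_ : _ = 1 - dot u1 u3 ^+ 2); [lra|rewrite -D13; ring].
exists a, b; split => //.
have E1 : dot u3 (u1 - u2) = (a - b) * (1 - c).
  by rewrite u3E dotC !dotDr !dotZr dotC dotBr e1 [dot (u1 - u2) u2]dotC dotBr e2
    (dotC u2 u1) -/c; ring.
have E3 : a ^+ 2 + b ^+ 2 + 2 * a * b * c = 1.
  rewrite -[RHS]e3 u3E dotDr !dotZr ![dot (_ + _) _]dotC !dotDr !dotZr e1 e2 (dotC u2 u1) -/c.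
  by ring.
(* With [a * b <= 0], the norm identity [E3] gives [1 <= (a - b) ^+ 2], so [H] yields
   [(1 - c) ^+ 2 <= 1 - c], impossible for [c < 0]. *)
rewrite ltNge; apply/negP => ab0.
have cm1 : -1 < c by rewrite expr2 in c1; nra.
have ab2 : (a - b) ^+ 2 = 1 + 2 * (- (a * b)) * (1 + c).
  by rewrite -[X in _ = X + _]E3; ring.
have ab1 : 1 <= (a - b) ^+ 2.
  by rewrite ab2 lerDl !mulr_ge0//; lra.
move: H; rewrite E1 exprMn => H.
have : (1 - c) ^+ 2 <= (a - b) ^+ 2 * (1 - c) ^+ 2 by rewrite ler_peMl// sqr_ge0.
move=> /le_trans/(_ H); rewrite expr2; nra.
Qed.

Lemma position_area (K : set plane) : convex_body K ->
  isominwidth_bisecting_position K ->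
  area K <= width K ^+ 2 /\ (area K = width K ^+ 2 -> is_square K).
Proof.
move=> bK pK; have [cK vK [z Kz]] := bK.
have K0 : K !=set0 by exists z; exact: interior_subset.
have w0 := width_gt0 K bK.
pose U := [set u : plane | dot u u = 1] `&` [set u | extent K u = width K].
have cU : compact U.
  apply: compact_circle.
  rewrite (_ : [set u | _] = extent K @^-1` [set x | x = width K])//.
  by apply: closed_comp; [move=> u _; exact: extent_continuous|exact: closed_eq].
have U0 : U !=set0 by have [u u1 Ku] := width_attained K cK K0; exists u.
have UU0 : U `*` U !=set0 by have [u Uu] := U0; exists (u, u).
have cf : continuous (fun p : plane * plane => dot p.1 p.2 ^+ 2).
  have cd (p : plane * plane) : {for p, continuous (fun p : plane * plane => dot p.1 p.2)}.
    apply: continuous_dot; [exact: continuous_fst1|exact: continuous_fst2|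
      exact: continuous_snd1|exact: continuous_snd2].
  by move=> p; apply: (@cvgM _ _ (nbhs p)); exact: cd.
(* The pair of contact directions closest to orthogonal. *)
have [[u1 u2]] := @compact_EVT_min _ _ _ _ UU0 (compact_setX cU cU)
  (continuous_subspaceT cf).
rewrite inE => -[/= [e1 x1] [e2 x2]] Hmin.
have {Hmin} M u v : U u -> U v -> dot u1 u2 ^+ 2 <= dot u v ^+ 2.
  by move=> Uu Uv; apply: (Hmin (u, v)); rewrite inE.
wlog d0 : u2 e2 x2 M / dot u1 u2 <= 0.
  move=> W; have [|d0] := leP (dot u1 u2) 0; first exact: W.
  apply: (W (- u2)).
  - by rewrite -e2 /dot /=; ring.
  - by rewrite /= extentN.
  - by move=> u v Uu Uv; rewrite dotC dotNl dotC sqrrN; exact: M.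
  - by rewrite dotC dotNl dotC oppr_le0 ltW.
have [d00|d00] := eqVneq (dot u1 u2) 0.
  have [a1 S1] := extent_strip K u1 cK K0; rewrite x1 in S1.
  have [a2 S2] := extent_strip K u2 cK K0; rewrite x2 in S2.
  exact: (@orthogonal_strips K u1 u2 a1 a2).
have {d00}dn : dot u1 u2 < 0 by rewrite lt_neqAle d00.
(* As [dot u1 u2 < 0], the vector [u1 - u2] bisects the smaller angle between the two lines; a
   contact direction far from it is neither [u1] nor [u2] up to sign. *)
pose n := Num.sqrt (dot (u1 - u2) (u1 - u2)).
have nE : dot (u1 - u2) (u1 - u2) = 2 * (1 - dot u1 u2).
  rewrite (_ : dot _ _ = dot u1 u1 + dot u2 u2 - 2 * dot u1 u2).
    by rewrite e1 e2; ring.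
  by rewrite /dot /=; ring.
have n2 : n ^+ 2 = 2 * (1 - dot u1 u2) by rewrite sqr_sqrtr nE//; lra.
have n0 : 0 < n by rewrite sqrtr_gt0 nE; lra.
have n0' := lt0r_neq0 n0.
have v1 : dot (n^-1 *: (u1 - u2)) (n^-1 *: (u1 - u2)) = 1.
  by rewrite dotZr dotC dotZr nE -n2; field.
have [u3 [e3 x3]] := position_contact K _ bK pK v1.
rewrite dotZr exprMn exprVn ler_pdivrMl ?exprn_gt0// n2 => H.
have {}H : dot u3 (u1 - u2) ^+ 2 <= 1 - dot u1 u2 by lra.
have [c1 [a [b [u3E ab a2 b2]]]] := contact_triple u1 u2 u3 e1 e2 e3 dn
  (M _ _ (conj e1 x1) (conj e3 x3)) (M _ _ (conj e2 x2) (conj e3 x3)) H.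
suff : area K < width K ^+ 2.
  by move=> lt; split=> [|E]; [exact: ltW|move: lt; rewrite E ltxx].
have abs_le1 (r : R) : r ^+ 2 <= 1 -> -1 <= r <= 1 by rewrite expr2; nra.
have := abs_le1 _ a2; have := abs_le1 _ b2 => /andP[b3 b4] /andP[a3 a4].
(* [a] and [b] have the same sign; if it is negative, the contact direction [- u3] is used
   instead. *)
have [a0|a0] := ltP 0 a.
  have b0 : 0 < b by rewrite -(pmulr_rgt0 _ a0).
  by apply: (@hexagon_strips K u1 u2 u3 a b) => //; apply/andP.
have {}a0 : a < 0 by rewrite lt_neqAle a0 andbT; apply: contraTneq ab => ->; rewrite mul0r ltxx.
have b0 : b < 0 by rewrite -(nmulr_rgt0 _ a0).
apply: (@hexagon_strips K u1 u2 (- u3) (- a) (- b)) => //.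
- by rewrite -e3 /dot /=; ring.
- by rewrite extentN.
- by rewrite u3E opprD !scaleNr.
- by lra.
- by lra.
Qed.

(** The strip between two opposite sides is as wide as the side is long. For a square in position,
    [position_area] supplies the reverse inequality. *)
Lemma square_width_le (K : set plane) : is_square K -> width K ^+ 2 <= area K.
Proof.
move=> [p [u [v [u0 uv uuvv KE]]]].
have uu : 0 < dot u u.
  rewrite lt_neqAle eq_sym; apply/andP; split; last by rewrite /dot addr_ge0// -expr2 sqr_ge0.
  apply: contra u0; rewrite /dot paddr_eq0 -?expr2 ?sqr_ge0// !sqrf_eq0.
  by move=> /andP[/eqP h1 /eqP h2]; rewrite [u]surjective_pairing h1 h2.
pose D := u.1 * v.2 - v.1 * u.2.
have D2 : D ^+ 2 = dot u u ^+ 2.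
  have := dot_detE u v; rewrite uv -uuvv expr0n add0r -expr2 => <-.
  by rewrite /D; ring.
have D0 : D != 0.
  by apply: contra_eq_neq D2 => ->; rewrite expr0n/= eq_sym expf_neq0// gt_eqF.
have Dn : `|D| = dot u u.
  by apply/eqP; rewrite -(eqrXn2 (ltn0Sn 1)) ?normr_ge0 ?(ltW uu)// real_normK ?num_real// D2.
have -> : K = affmap u.1 v.1 u.2 v.2 p.1 p.2 @` box 0 1 0 1.
  rewrite KE; apply/seteqP; split=> [x [s [t [s01 t01 ->]]]|_ [[s t] [/= s01 t01] <-]].
    exists (s, t); first by split; rewrite /= in_itv.
    rewrite [RHS]surjective_pairing /affmap; congr pair => /=; rewrite /GRing.scale /=; ring.
  exists s, t; rewrite !in_itv/= in s01 t01; split => //.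
  rewrite [RHS]surjective_pairing /affmap; congr pair => /=; rewrite /GRing.scale /=; ring.
rewrite area_affmap// ?area_box ?Dn; [|by []|by []|exact: compact_box].
rewrite subr0 !mulr1.
pose n := Num.sqrt (dot u u).
have n0 : 0 < n by rewrite sqrtr_gt0.
have n0' := lt0r_neq0 n0.
have n2 : n ^+ 2 = dot u u by rewrite sqr_sqrtr// ltW.
rewrite -n2 ler_sqr ?nnegrE ?width_ge0 ?(ltW n0)//.
pose c := dot (n^-1 *: u) p.
rewrite -[leRHS](addKr c) addrC.
apply: (width_le _ (n^-1 *: u)).
- by rewrite dotZr dotC dotZr -n2; field.
- by rewrite lerDl ltW.
move=> _ [[s t] [/= s01 t01] <-].
rewrite (_ : dot _ _ = c + n * s).
  rewrite !in_itv/= in s01; rewrite lerDl lerD2l mulr_ge0 ?ler_piMr ?(ltW n0)//; lra.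
rewrite /c (_ : dot (n^-1 *: u) (affmap _ _ _ _ _ _ _) =
  dot (n^-1 *: u) p + s * (n^-1 * dot u u) + t * n^-1 * dot u v).
  by rewrite uv -n2; field.
by rewrite /affmap /dot /= /GRing.scale /=; ring.
Qed.

End Plane.

Theorem theorem1p9 (R : realType) (K : set (R * R)) (hK : convex_body K)
    (hpos : isominwidth_bisecting_position K) :
  area K / bisecting_width K ^+ 2 <= 4 /\
  (area K / bisecting_width K ^+ 2 = 4 <-> is_square K).
Proof.
have w0 : 0 < (width K / 2) ^+ 2 by rewrite exprn_gt0// divr_gt0 ?width_gt0.
have [Ale Aeq] := position_area K hK hpos.
have E : 4 * (width K / 2) ^+ 2 = width K ^+ 2 by field.
rewrite bisecting_widthE// ler_pdivrMr// E; split => //; split=> [A4|sq].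
  by apply: Aeq; rewrite -E -A4 divfK// gt_eqF.
rewrite (_ : area K = width K ^+ 2) -?E ?mulfK ?gt_eqF//.
by apply/eqP; rewrite eq_le E Ale square_width_le.
Qed.
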